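(* Let $R$ be an associative ring with identity. The following properties hold: (1) For any left $R$-module $M$ and any right $R$-module $N$, if $N^+\in\mathfrak{F}^{-1}(M)$ then $N\in\underline{\mathfrak{In}}^{-1}(M^+)$. (2) The ring $R$ is right coherent if and only if for any left $R$-module $M$ and any right $R$-module $N$, if $N\in\underline{\mathfrak{In}}^{-1}(M^+)$ then $N^+\in\mathfrak{F}^{-1}(M)$.
   Context: Modules are unital; $N^+=\mathrm{Hom}_{\mathbb{Z}}(N,\mathbb{Q}/\mathbb{Z})$ is the character module (of a left module it is a right module and vice versa). A flat precover of a module $N$ is a morphism $g:F\to N$ with $F$ flat such that $\mathrm{Hom}(F',F)\to\mathrm{Hom}(F',N)$ is surjective for every flat module $F'$. For a left $R$-module $M$, the flat-precover completing domain $\mathfrak{F}^{-1}(M)$ is the class of all left $R$-modules $N$ such that for every morphism $f:M\to N$ and every flat precover $g:F\to N$ there is a morphism $h:M\to F$ with $gh=f$. For a right $R$-module $L$, the subinjectivity domain $\underline{\mathfrak{In}}^{-1}(L)$ is the class of all right $R$-modules $N$ such that for every right $R$-module $K$ containing $N$ as a submodule and every morphism $f:N\to L$ there is a morphism $g:K\to L$ with $g|_N=f$. *)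

(* Defs.v *)
From HB Require Import structures.
From mathcomp Require Import all_boot all_algebra.
From mathcomp Require Import boolp.
From mathcomp Require Import freeg.

Set Implicit Arguments.
Unset Strict Implicit.
Unset Printing Implicit Defensive.

Import GRing.Theory.
Local Open Scope ring_scope.
Local Open Scope quotient_scope.

(* A left R-module is a lmodType R; a right R-module is a lmodType R^c, where
   R^c is the converse ring: for N : lmodType R^c, r *: x stands for x r. *)

Section HomZ.
Variables U V : zmodType.
Implicit Types f g h : {additive U -> V}.

Lemma additive_ext f g : f =1 g -> f = g.
Proof.
case: f => f [[f0]]; case: g => g [[g0]] /= /funext fg.
by case: _ / fg g0 => g0; rewrite (Prop_irrelevance f0 g0).
Qed.

HB.instance Definition _ := gen_eqMixin {additive U -> V}.
HB.instance Definition _ := gen_choiceMixin {additive U -> V}.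

Definition hom0 : {additive U -> V} := \0.
Definition homD f g : {additive U -> V} := f \+ g.
Definition homN f : {additive U -> V} := \- f.

Fact homDA : associative homD.
Proof. by move=> f g h; apply: additive_ext => x /=; rewrite addrA. Qed.
Fact homDC : commutative homD.
Proof. by move=> f g; apply: additive_ext => x /=; rewrite addrC. Qed.
Fact hom0D : left_id hom0 homD.
Proof. by move=> f; apply: additive_ext => x /=; rewrite add0r. Qed.
Fact homND : left_inverse hom0 homN homD.
Proof. by move=> f; apply: additive_ext => x /=; rewrite addNr. Qed.

HB.instance Definition _ :=
  GRing.isZmodule.Build {additive U -> V} homDA homDC hom0D homND.

End HomZ.


Definition ratint : {pred rat} := [pred q | q \is a Num.int].

Fact ratint_zmod_closed : zmod_closed ratint.
Proof. by split=> [|x y]; rewrite !inE ?rpred0 //; exact: rpredB. Qed.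
HB.instance Definition _ :=
  GRing.isZmodClosed.Build rat ratint ratint_zmod_closed.

Definition QmodZ : zmodType := Quotient.quot ratint.

(* The character module M^+ = Hom_Z(M, Q/Z) of a left module M, as a right
   module: (f r)(x) = f (r x). *)
Definition lchar (R : pzRingType) (M : lmodType R) : Type :=
  {additive M -> QmodZ}.

Section LeftCharacter.
Variables (R : pzRingType) (M : lmodType R).

HB.instance Definition _ := GRing.Zmodule.copy (lchar M) {additive M -> QmodZ}.

Definition lchar_scale (r : R^c) (f : lchar M) : lchar M :=
  (f : {additive M -> QmodZ}) \o *:%R (r : R).

Fact lchar_scaleA r s f :
  lchar_scale r (lchar_scale s f) = lchar_scale (r * s) f.
Proof. by apply: additive_ext => x /=; rewrite scalerA. Qed.
Fact lchar_scale1 : left_id 1 lchar_scale.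
Proof. by move=> f; apply: additive_ext => x /=; rewrite scale1r. Qed.
Fact lchar_scaleDr : right_distributive lchar_scale +%R.
Proof. by move=> r f g; apply: additive_ext. Qed.
Fact lchar_scaleDl f : {morph lchar_scale^~ f : r s / r + s}.
Proof. by move=> r s; apply: additive_ext => x /=; rewrite scalerDl raddfD. Qed.

HB.instance Definition _ := GRing.Zmodule_isLmodule.Build R^c (lchar M)
  lchar_scaleA lchar_scale1 lchar_scaleDr lchar_scaleDl.

End LeftCharacter.

(* The character module of a right module N, as a left module:
   (r f)(x) = f (x r). *)
Definition rchar (R : pzRingType) (N : lmodType R^c) : Type :=
  {additive N -> QmodZ}.

Section RightCharacter.
Variables (R : pzRingType) (N : lmodType R^c).

HB.instance Definition _ := GRing.Zmodule.copy (rchar N) {additive N -> QmodZ}.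

Definition rchar_scale (r : R) (f : rchar N) : rchar N :=
  (f : {additive N -> QmodZ}) \o *:%R (r : R^c).

Fact rchar_scaleA r s f :
  rchar_scale r (rchar_scale s f) = rchar_scale (r * s) f.
Proof. by apply: additive_ext => x /=; rewrite scalerA. Qed.
Fact rchar_scale1 : left_id 1 rchar_scale.
Proof. by move=> f; apply: additive_ext => x /=; rewrite scale1r. Qed.
Fact rchar_scaleDr : right_distributive rchar_scale +%R.
Proof. by move=> r f g; apply: additive_ext. Qed.
Fact rchar_scaleDl f : {morph rchar_scale^~ f : r s / r + s}.
Proof.
by move=> r s; apply: additive_ext => x /=; rewrite (scalerDl x) raddfD.
Qed.

HB.instance Definition _ := GRing.Zmodule_isLmodule.Build R (rchar N)
  rchar_scaleA rchar_scale1 rchar_scaleDr rchar_scaleDl.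

End RightCharacter.

Definition subgroup_gen (V : zmodType) (G : V -> Prop) : {pred V} :=
  [pred x | `[< forall S : zmodClosed V, (forall y, G y -> y \in S) -> x \in S >]].

Fact subgroup_gen_closed (V : zmodType) (G : V -> Prop) :
  zmod_closed (subgroup_gen G).
Proof.
split=> [|x y]; first by rewrite inE; apply/asboolP => S _; exact: rpred0.
rewrite !inE => /asboolP Gx /asboolP Gy; apply/asboolP => S GS.
by rewrite rpredB ?Gx ?Gy.
Qed.
HB.instance Definition _ (V : zmodType) (G : V -> Prop) :=
  GRing.isZmodClosed.Build V (subgroup_gen G) (subgroup_gen_closed G).

(* The tensor product of a right module A and a left module M over R: the
   quotient of the free abelian group on A * M by the subgroup generated by the
   biadditivity and balancing relations. *)
Section Tensor.
Variables (R : pzRingType) (A : lmodType R^c) (M : lmodType R).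

Local Notation free := {freeg (A * M)%type}.
Local Notation ftensor a m := (<< (a, m) >> : free).

Inductive tensor_relator : free -> Prop :=
| TensorDl (a b : A) (m : M) :
    tensor_relator (ftensor (a + b) m - (ftensor a m + ftensor b m))
| TensorDr (a : A) (m n : M) :
    tensor_relator (ftensor a (m + n) - (ftensor a m + ftensor a n))
| TensorZ (a : A) (r : R) (m : M) :
    tensor_relator (ftensor ((r : R^c) *: a) m - ftensor a (r *: m)).

Definition tensor : zmodType := Quotient.quot (subgroup_gen tensor_relator).

Definition pure_tensor (a : A) (m : M) : tensor := \pi_tensor (ftensor a m).

End Tensor.

(* f \otimes M : A \otimes_R M -> B \otimes_R M, sending a \otimes m to
   f a \otimes m; see tensor_map_is_zmod_morphism and tensor_mapE. *)
Section TensorMap.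
Variables (R : pzRingType) (A B : lmodType R^c) (f : {linear A -> B}).
Variable M : lmodType R.

Definition free_map : {freeg (A * M)%type} -> {freeg (B * M)%type} :=
  fglift (fun k => << (f k.1, k.2) >>).

Definition tensor_map (t : tensor A M) : tensor B M :=
  \pi_(tensor B M) (free_map (repr t)).

Fact free_map_is_zmod_morphism : zmod_morphism free_map.
Proof. exact: lift_is_additive. Qed.
HB.instance Definition _ :=
  GRing.isZmodMorphism.Build _ _ free_map free_map_is_zmod_morphism.

Lemma free_mapE a m : free_map << (a, m) >> = << (f a, m) >>.
Proof. by rewrite /free_map liftU scale1r. Qed.

Let free_mapD u v : free_map (u + v) = free_map u + free_map v.
Proof. exact: raddfD. Qed.
Let free_mapB u v : free_map (u - v) = free_map u - free_map v.
Proof. exact: raddfB. Qed.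

Lemma tensor_map_pi u :
  tensor_map (\pi_(tensor A M) u) = \pi_(tensor B M) (free_map u).
Proof.
apply/eqP; rewrite -Quotient.idealrBE -raddfB /=.
pose S : pred _ := fun x => free_map x \in subgroup_gen (@tensor_relator R B M).
have Sz : zmod_closed S.
  split=> [|x y]; first by rewrite -topredE /= /S raddf0 rpred0.
  by rewrite -!topredE /= /S raddfB; exact: rpredB.
pose SC := GRing.isZmodClosed.Build _ S Sz.
pose S' : zmodClosed _ := HB.pack S SC.
have : repr (\pi_(tensor A M) u) - u \in subgroup_gen (@tensor_relator R A M).
  by rewrite Quotient.idealrBE reprK.
rewrite inE => /asboolP /(_ S'); apply=> y hy.
rewrite -topredE /= /S inE; apply/asboolP => T; apply.
case: hy => [a b m|a m n|a r m]; rewrite free_mapB ?free_mapD !free_mapE.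
- by rewrite (raddfD f); exact: TensorDl.
- exact: TensorDr.
- by rewrite linearZ_LR; exact: TensorZ.
Qed.

Lemma tensor_map_is_zmod_morphism : zmod_morphism tensor_map.
Proof.
move=> x y; rewrite -[x]reprK -[y]reprK -raddfB !tensor_map_pi.
by rewrite !raddfB.
Qed.

Lemma tensor_mapE a m : tensor_map (pure_tensor a m) = pure_tensor (f a) m.
Proof. by rewrite tensor_map_pi free_mapE. Qed.

End TensorMap.

Arguments tensor_map {R A B} f M t.

Definition flat (R : pzRingType) (F : lmodType R) : Prop :=
  forall (A B : lmodType R^c) (f : {linear A -> B}),
    injective f -> injective (tensor_map f F).

Definition flat_precover (R : pzRingType) (F N : lmodType R)
    (g : {linear F -> N}) : Prop :=
  flat F /\
  forall F' : lmodType R, flat F' ->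
    forall f : {linear F' -> N}, exists h : {linear F' -> F}, g \o h =1 f.

Definition flat_precover_completing_domain (R : pzRingType) (M N : lmodType R)
    : Prop :=
  forall (f : {linear M -> N}) (F : lmodType R) (g : {linear F -> N}),
    flat_precover g -> exists h : {linear M -> F}, g \o h =1 f.

(* An overmodule K of N is given by its inclusion i : N -> K. *)
Definition subinjectivity_domain (R : pzRingType) (L N : lmodType R^c) : Prop :=
  forall (K : lmodType R^c) (i : {linear N -> K}), injective i ->
    forall f : {linear N -> L}, exists g : {linear K -> L}, g \o i =1 f.

Section Submodule.
Variables (A : pzRingType) (V : lmodType A) (S : submodClosed V).

Inductive submod : predArgType := Submod u & u \in S.

Definition submod_val w : V := let: Submod u _ := w in u.
HB.instance Definition _ := [isSub of submod for submod_val].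
HB.instance Definition _ := [Choice of submod by <:].
HB.instance Definition _ := [SubChoice_isSubLmodule of submod by <:].

End Submodule.

(* A^n -> V -> 0 exact *)
Definition finitely_generated (A : pzRingType) (V : lmodType A) : Prop :=
  exists (n : nat) (p : {linear 'rV[A]_n -> V}), forall v, exists x, p x = v.

(* A^m -> A^n -> V -> 0 exact *)
Definition finitely_presented (A : pzRingType) (V : lmodType A) : Prop :=
  exists (m n : nat) (q : {linear 'rV[A]_m -> 'rV[A]_n})
         (p : {linear 'rV[A]_n -> V}),
    (forall v, exists x, p x = v) /\
    (forall x, p x = 0 <-> exists z, q z = x).

(* (R^c)^o is R as a right module over itself, so the I are the right ideals. *)
Definition right_coherent (R : pzRingType) : Prop :=
  forall I : submodClosed (R^c)^o,
    finitely_generated (submod I) -> finitely_presented (submod I).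

(* Main.v *)
Require Import Defs.
From HB Require Import structures.
From mathcomp Require Import all_boot all_algebra.
From mathcomp Require Import boolp classical_sets freeg.

(* For a left module F, the character module F^+ is injective iff F is flat, iff
   F satisfies the equational criterion; Hom(N, M^+) = Hom(M, N^+) by
   adjunction.  Hence, if g : F -> N^+ is a flat precover, the transpose
   N -> F^+ of g extends to any overmodule K of N, and composing with a lift
   M -> F of a given M -> N^+ gives (1).

   Flat precovers exist: a map phi : F -> N with F flat factors through F / P,
   where P is maximal among the submodules of ker phi with flat quotient.  If
   P = 0, then F is exhausted by a set of names depending only on R and N
   (reduced_skolem_hull), so that the direct sum of the flat quotients of one
   fixed free module is a flat precover of N.

   For (2), if R is right coherent and N embeds in an injective E, then E^+ is
   flat and M -> N^+ factors through E^+ -> N^+, which lifts to F.  Conversely,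
   for E injective the identity of E^+ lifts along a flat precover, so E^+ is
   flat; applied to a product E of copies of R^+ indexed by the syzygies of a
   column a, the equational criterion in E^+ yields finitely many generating
   syzygies. *)

Set Implicit Arguments.
Unset Strict Implicit.
Unset Printing Implicit Defensive.

Import GRing.Theory Num.Theory.
Local Open Scope ring_scope.
Local Open Scope quotient_scope.

(** * Injective modules *)

Definition linear_pack (R : pzRingType) (U V : lmodType R) (f : U -> V)
    (fL : linear f) : {linear U -> V} :=
  HB.pack f (GRing.isLinear.Build R U V *:%R f fL).

Definition additive_pack (U V : zmodType) (f : U -> V)
    (fA : zmod_morphism f) : {additive U -> V} :=
  HB.pack f (GRing.isZmodMorphism.Build U V f fA).

Definition is_submodule (R : pzRingType) (V : lmodType R) (P : V -> Prop) :=
  P 0 /\ forall (r : R) x y, P x -> P y -> P (r *: x + y).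

Section IsSubmodule.
Variables (R : pzRingType) (V : lmodType R) (P : V -> Prop).
Hypothesis PS : is_submodule P.

Lemma is_submoduleD x y : P x -> P y -> P (x + y).
Proof. by move=> Px Py; rewrite -[x]scale1r; apply: PS.2. Qed.

Lemma is_submoduleZ r x : P x -> P (r *: x).
Proof. by move=> Px; rewrite -[_ *: _]addr0; apply: PS.2 => //; case: PS. Qed.

Lemma is_submoduleN x : P x -> P (- x).
Proof. by move=> Px; rewrite -scaleN1r; apply: is_submoduleZ. Qed.

Lemma is_submoduleB x y : P x -> P y -> P (x - y).
Proof. by move=> Px Py; apply: is_submoduleD => //; apply: is_submoduleN. Qed.

End IsSubmodule.

(* Partial linear maps are given by their graphs. *)
Definition partial_linear (R : pzRingType) (B E : lmodType R)
    (G : B * E -> Prop) :=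
  is_submodule G /\ forall e, G (0, e) -> e = 0.

Definition injective_module (R : pzRingType) (E : lmodType R) :=
  forall (B : lmodType R) (G : B * E -> Prop), partial_linear G ->
  exists g : {linear B -> E}, forall b e, G (b, e) -> g b = e.

Lemma partial_linear_fun (R : pzRingType) (B E : lmodType R)
    (G : B * E -> Prop) b e e' :
  partial_linear G -> G (b, e) -> G (b, e') -> e = e'.
Proof.
move=> [GS G0] Ge Ge'; apply/eqP; rewrite -subr_eq0; apply/eqP/G0.
have -> : (0, e - e') = (b, e) - (b, e') :> B * E by rewrite -{1}(subrr b).
exact: is_submoduleB.
Qed.

Section Baer.
Variables (R : pzRingType) (E : lmodType R).
Hypothesis baerE : forall G : R^o * E -> Prop, partial_linear G ->
  exists e, forall (s : R) e', G (s, e') -> e' = s *: e.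

Section Extend.
Variables (B : lmodType R) (G : B * E -> Prop).
Hypothesis GP : partial_linear G.

Local Notation partial_ext A := (partial_linear (fun p => A p \/ G p)).

(** The condition is imposed on the union of [A] with [G] because the chains in [Zorn_bigcup] may be
    empty: the empty union then yields [G] itself. *)
Lemma maximal_partial_linear :
  exists A : set (B * E),
    partial_ext A /\ forall A' : set (B * E), (A `<` A')%classic -> ~ partial_ext A'.
Proof.
apply: (@Zorn_bigcup _ (fun A => partial_ext A)) => C CP Ctot.
have [[A0 CA0]|C0] := pselect (exists A, C A); last first.
  suff -> : (fun p => (\bigcup_(X in C) X)%classic p \/ G p) = G by [].
  apply/funext => p; apply/propext; split; last by right.
  by case=> // -[A CA _]; case: C0; exists A.
have in1 p : (\bigcup_(X in C) X)%classic p \/ G p ->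
    exists2 A, C A & A p \/ G p.
  by case=> [[A CA Ap]|Gp]; [exists A => //; left|exists A0 => //; right].
split; first split.
- by right; case: GP => -[].
- move=> r x y /in1[A CA Ax] /in1[A' CA' Ay].
  wlog [D CD [Dx Dy]] : / exists2 D, C D & (D x \/ G x) /\ (D y \/ G y).
    apply; case: (Ctot _ _ CA CA') => AA'; [exists A'|exists A] => //; split => //.
      by case: Ax => [/AA'|]; [left|right].
    by case: Ay => [/AA'|]; [left|right].
  have [[_ DS] _] := CP _ CD.
  by case: (DS r _ _ Dx Dy) => [Dxy|]; [left; exists D|right].
- by move=> e /in1[A CA Ae]; have [_] := CP _ CA; apply.
Qed.

(** A maximal extension [H] is total. The scalars [s] with [s *: b] in the domain of [H] form a left
    ideal, on which Baer's hypothesis gives a candidate value [e0] for [b]. Adjoining [(b, e0)]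
    keeps the graph functional, so maximality forces it into [H]. *)
Lemma baer_extension :
  exists g : {linear B -> E}, forall b e, G (b, e) -> g b = e.
Proof.
have [A [AP Amax]] := maximal_partial_linear.
pose H p := A p \/ G p.
have HP : partial_linear H := AP.
have HS : is_submodule H by case: HP.
have tot b : exists e, H (b, e).
  have [|e0 e0P] := baerE (G := fun p => H ((p.1 : R) *: b, p.2)).
    split; first split=> [|r [x1 x2] [y1 y2]] /=.
    - by rewrite scale0r; case: HS.
    - rewrite scalerDl -scalerA => Hx Hy.
      exact: (HS.2 r (_, _) (_, _) Hx Hy).
    - by move=> e /=; rewrite scale0r; case: HP => _; apply.
  pose H' (p : B * E) := exists (s : R) q, H q /\ p = s *: (b, e0) + q.
  have HH' p : H p -> H' p by exists 0, p; rewrite scale0r add0r.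
  have H'P : partial_linear H'.
    split; first split=> [|r x y].
    - by apply: HH'; case: HS.
    - move=> [s [q [Hq ->]]] [t [q' [Hq' ->]]].
      exists (r * s + t), (r *: q + q'); split; first exact: HS.2.
      by rewrite scalerDr scalerDl scalerA addrACA.
    - move=> e [s [[q1 q2] [Hq /pair_equal_spec[/= /esym/eqP]]]].
      rewrite addr_eq0 => /eqP sb ->.
      have /(e0P s) <- : H (s *: b, - q2).
        by rewrite sb; apply: (is_submoduleN HS Hq).
      by rewrite addNr.
  have [Hb|Hb] := pselect (H (b, e0)); first by exists e0.
  case: (Amax H').
    split; first by move=> p Ap; apply: HH'; left.
    move=> H'A; apply: Hb; left; apply: H'A; exists 1, 0; split; first by case: HS.
    by rewrite scale1r addr0.
  suff -> : (fun p => H' p \/ G p) = H' by [].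
  apply/funext => p; apply/propext; split; last by left.
  by case=> // Gp; apply: HH'; right.
have [g gP] := choice tot.
have gL : linear g.
  move=> r x y; apply: (partial_linear_fun HP (gP _)).
  exact: (HS.2 r (_, _) (_, _) (gP x) (gP y)).
exists (linear_pack gL) => b e Gb /=.
by apply: (partial_linear_fun HP (gP b)); right.
Qed.

End Extend.

Theorem baer_criterion : injective_module E.
Proof. by move=> B G; apply: baer_extension. Qed.

End Baer.

Lemma injective_module_extend (R : pzRingType) (E A B : lmodType R)
    (i : {linear A -> B}) (h : {linear A -> E}) :
  injective_module E -> injective i ->
  exists g : {linear B -> E}, g \o i =1 h.
Proof.
move=> Einj i_inj.
have [|g gP] := Einj B (fun p => exists a, p = (i a, h a)).
  split; first split=> [|r x y].
  - by exists 0; rewrite !linear0.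
  - by move=> [a ->] [b ->]; exists (r *: a + b); rewrite !linearP.
  - by move=> e [a [/esym/eqP]]; rewrite raddf_eq0 // => /eqP-> ->; rewrite linear0.
by exists g => a; apply: gP; exists a.
Qed.

(** The graph is itself a module. Its first projection is injective because the graph is functional,
    and extending the second projection along it extends the partial map. *)
Lemma extend_injective_module (R : pzRingType) (E : lmodType R) :
  (forall (A B : lmodType R) (i : {linear A -> B}) (h : {linear A -> E}),
     injective i -> exists g : {linear B -> E}, g \o i =1 h) ->
  injective_module E.
Proof.
move=> ext B G [GS G0].
pose S : pred (B * E) := fun p => `[< G p >].
have S_closed : submod_closed S.
  split=> [|r x y]; first by apply/asboolP; case: GS.
  by move=> /asboolP Gx /asboolP Gy; apply/asboolP; apply: GS.2.
pose SC := GRing.isSubmodClosed.Build R (B * E)%type S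
  (GRing.submod_closed_semi S_closed).
pose S' : submodClosed (B * E)%type := HB.pack S SC.
pose i0 (w : submod S') : B := (val w).1.
pose h0 (w : submod S') : E := (val w).2.
have iL : linear i0 by [].
have hL : linear h0 by [].
have [|g gP] := ext _ _ (linear_pack iL) (linear_pack hL).
  apply: raddf_inj => -[[b e] Sbe] /= b0; apply/val_inj => /=.
  rewrite /i0 /= in b0; move: Sbe => /asboolP; rewrite b0 => Ge.
  by rewrite (G0 _ Ge).
exists g => b e Gbe.
have Sbe : (b, e) \in S' by apply/asboolP.
exact: (gP (Submod Sbe)).
Qed.

(** * The injective cogenerator Q/Z *)

Definition ratmod : rat -> QmodZ := \pi_QmodZ.

Lemma ratmodB x y : ratmod (x - y) = ratmod x - ratmod y.
Proof. by rewrite /ratmod raddfB. Qed.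

HB.instance Definition _ := GRing.isZmodMorphism.Build rat QmodZ ratmod ratmodB.

Lemma ratmod_eq0 x : (ratmod x == 0) = (x \is a Num.int).
Proof.
have <- : ratmod 0 = 0 := raddf0 ratmod.
by rewrite /ratmod -Quotient.idealrBE subr0.
Qed.

Lemma QmodZ_divisible (x : QmodZ) (d : int) : d != 0 -> exists y, x = y *~ d.
Proof.
move=> d0; exists (ratmod (repr x / d%:~R)).
rewrite -raddfMz -mulrzl mulrCA divff ?intr_eq0 // mulr1.
exact/esym/(reprK x).
Qed.

Definition is_subgroup (V : zmodType) (H : V -> Prop) :=
  H 0 /\ forall x y, H x -> H y -> H (x - y).

Section IsSubgroup.
Variables (V : zmodType) (H : V -> Prop).
Hypothesis HS : is_subgroup H.

Lemma is_subgroupN x : H x -> H (- x).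
Proof. by move=> Hx; rewrite -sub0r; apply: HS.2 => //; case: HS. Qed.

Lemma is_subgroupD x y : H x -> H y -> H (x + y).
Proof. by move=> Hx Hy; rewrite -[y]opprK; apply: HS.2 => //; apply: is_subgroupN. Qed.

Lemma is_subgroupMz x (n : int) : H x -> H (x *~ n).
Proof.
move=> Hx; have Hn k : H (x *+ k).
  by elim: k => [|k IH]; [case: HS|rewrite mulrS; apply: is_subgroupD].
case: n => n; first by rewrite -pmulrn.
by rewrite NegzE mulrNz; apply: is_subgroupN; rewrite -pmulrn.
Qed.


End IsSubgroup.

Lemma int_subgroup_principal (H : int -> Prop) : is_subgroup H ->
  exists2 d : nat, H d & forall n, H n -> (d %| n)%Z.
Proof.
move=> HS; have Habs n : H n -> H `|n|%N.
  by case: (intP n) => // k Hk; rewrite abszN; have := is_subgroupN HS Hk; rewrite opprK.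
(* Without a positive element the subgroup is trivial and [d] is 0; otherwise [d] is the least
   positive element. *)
have [[n0 Hn0]|H0] := pselect (exists n : nat, H n.+1); last first.
  exists 0%N; first by case: HS.
  move=> n /Habs; rewrite dvd0z; case: (intP n) => // k; rewrite ?abszN => Hk;
    by case: H0; exists k.
have ex : exists n : nat, `[< H n.+1 >] by exists n0; apply/asboolP.
case: (ex_minnP ex) => d /asboolP Hd dmin; exists d.+1 => // n Hn.
have : H (n %% d.+1)%Z.
  rewrite /modz; apply: HS.2 => //.
  by rewrite mulrC -mulrzz; apply: is_subgroupMz.
have := ltz_pmod n (isT : 0 < d.+1%:Z :> int); have := modz_ge0 n (isT : d.+1%:Z != 0).
move=> mge mlt Hm; apply/dvdz_mod0P; move: mge mlt Hm.
case: (n %% d.+1)%Z => //= -[|k] // _ kd Hk.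
have := dmin k (introT (asboolP _) Hk); rewrite leqNgt; rewrite ltz_nat ltnS in kd.
by rewrite kd.
Qed.

Lemma QmodZ_injective : injective_module (zmodule QmodZ).
Proof.
apply: baer_criterion => G GP; have [GS G0] := GP.
have [|d [ed Gd] dP] := @int_subgroup_principal (fun n => exists e, G (n, e)).
  split; first by exists 0; case: GS.
  by move=> x y [e Ge] [e' Ge']; exists (e - e'); apply: (is_submoduleB GS Ge Ge').
(* The domain is generated by [d], so a map is extended by dividing its value at [d]; for [d = 0]
   functionality forces [ed = 0]. *)
have [e eP] : exists e : QmodZ, ed = e *~ d.
  have [d0|/QmodZ_divisible//] := eqVneq (d : int) 0.
  by exists 0; rewrite mul0rz; apply: G0; rewrite -d0.
exists e => s e' Ge'; have /dvdzP[q sq] : (d %| s)%Z by apply: dP; exists e'.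
apply: (partial_linear_fun GP Ge'); rewrite sq.
suff -> : (q * d, (q * d) *: (e : zmodule QmodZ)) = q *: ((d : int^o), ed)
    :> (int^o * zmodule QmodZ)%type.
  exact: is_submoduleZ.
by congr pair; rewrite eP -scalezrE scalerA.
Qed.

Lemma character_extend (V : zmodType) (G : V * QmodZ -> Prop) :
  is_subgroup G -> (forall e, G (0, e) -> e = 0) ->
  exists f : {additive V -> QmodZ}, forall v e, G (v, e) -> f v = e.
Proof.
move=> GS G0.
have [|g gP] := @QmodZ_injective (zmodule V) G.
  split=> //; split; first by case: GS.
  move=> r x y Gx Gy; apply: is_subgroupD => //.
  by rewrite -[r]intz scaler_int; apply: is_subgroupMz.
by exists (g : {additive V -> QmodZ}).
Qed.

Lemma invr_nat_nint (d : nat) : (1 < d)%N -> (d%:R^-1 : rat) \isn't a Num.int.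
Proof.
move=> d1; apply/negP => /intrP[m dm].
have: 0 < (d%:R^-1 : rat) < 1.
  by rewrite invr_gt0 ltr0n ltnW //= invf_lt1 ?ltr0n ?ltr1n // ltnW.
by rewrite dm ltr0z ltrz1; case: m {dm} => -[|m].
Qed.

(** On the subgroup generated by [v] and [H], the assignment [n v + h |-> n / d] modulo the integers
    is well defined for a suitable [d > 1]; it extends because Q/Z is injective. *)
Lemma character_separates (V : zmodType) (H : V -> Prop) v :
  is_subgroup H -> ~ H v ->
  exists2 f : {additive V -> QmodZ}, f v <> 0 & forall x, H x -> f x = 0.
Proof.
move=> HS Hv.
have [|d0 Hd0 d0P] := @int_subgroup_principal (fun n => H (v *~ n)).
  split; first by rewrite mulr0z; case: HS.
  by move=> x y Hx Hy; rewrite mulrzBr; apply: HS.2.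
(* The order of [v] modulo [H]; when that order is infinite ([d0 = 0]) any integer above 1 would
   do. *)
pose d : rat := if d0 is 0%N then 2 else d0%:R.
have dP n : H (v *~ n) -> n%:~R / d \is a Num.int.
  move=> /d0P; rewrite /d; case: d0 {Hd0 d0P d} => [|d0].
    by rewrite dvd0z => /eqP ->; rewrite mul0r.
  move=> /dvdzP[q ->]; rewrite intrM mulfK ?intr_eq0 //; exact: intr_int.
have d1 : d^-1 \isn't a Num.int.
  rewrite /d; case: d0 {dP d d0P} Hd0 => [_|[|d0 _]].
  - exact: (@invr_nat_nint 2).
  - by move=> Hd0; case: Hv; rewrite -[v]mulr1z.
  - exact: invr_nat_nint.
have [||f fP] := @character_extend V
    (fun p => exists (n : int) h, H h /\ p = (v *~ n + h, ratmod (n%:~R / d))).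
- split.
    exists 0, 0; rewrite mulr0z mul0r addr0 raddf0; split=> //; by case: HS.
  move=> x y [n [h [Hh ->]]] [n' [h' [Hh' ->]]].
  exists (n - n'), (h - h'); split; first exact: HS.2.
  congr pair => /=; first by rewrite mulrzBr opprD addrACA.
  by rewrite intrB mulrBl ratmodB.
- move=> e [n [h [Hh [/esym/eqP]]]]; rewrite addr_eq0 => /eqP vn ->.
  by apply/eqP; rewrite ratmod_eq0; apply: dP; rewrite vn; apply: is_subgroupN.
exists f.
  rewrite (fP v (ratmod d^-1)); first by move=> /eqP; rewrite ratmod_eq0 (negbTE d1).
  by exists 1, 0; rewrite mulr1z addr0 mul1r; split=> //; case: HS.
move=> x Hx; apply: fP; exists 0, x.
by rewrite mulr0z add0r mul0r raddf0.
Qed.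

(** * Flatness and character modules *)

Section FreeLift.
Variables (K : choiceType) (V : zmodType).

Definition free_lift (b : K -> V) : {additive {freeg K} -> V} :=
  additive_pack (lift_is_additive (b : K -> zmodule V)).

Lemma free_liftE b k : free_lift b << k >> = b k.
Proof. by rewrite /free_lift /= liftU scale1r. Qed.

Lemma free_additive_ext (f g : {additive {freeg K} -> V}) :
  (forall k, f << k >> = g << k >>) -> f =1 g.
Proof.
move=> fg; elim/freeg_ind_dom0 => [|k x D _ _ IH]; first by rewrite !raddf0.
have -> : << k *g x >> = << x >> *~ k :> {freeg K}.
  by rewrite freegU_mulz intz.
by rewrite !raddfD !raddfMz fg IH.
Qed.

End FreeLift.

Section PureTensor.
Variables (R : pzRingType) (A : lmodType R^c) (M : lmodType R).

Lemma tensor_relator_eq0 u : @tensor_relator R A M u -> \pi_(tensor A M) u = 0.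
Proof.
move=> ru; apply/eqP; rewrite -[0](raddf0 \pi_(tensor A M)) -Quotient.idealrBE.
by rewrite subr0 inE => S; apply.
Qed.

Lemma pure_tensorDl (a b : A) (m : M) :
  pure_tensor (a + b) m = pure_tensor a m + pure_tensor b m.
Proof.
apply/eqP; rewrite /pure_tensor -raddfD -subr_eq0 -raddfB.
exact/eqP/tensor_relator_eq0/TensorDl.
Qed.

Lemma pure_tensorDr (a : A) (m n : M) :
  pure_tensor a (m + n) = pure_tensor a m + pure_tensor a n.
Proof.
apply/eqP; rewrite /pure_tensor -raddfD -subr_eq0 -raddfB.
exact/eqP/tensor_relator_eq0/TensorDr.
Qed.

Lemma pure_tensorZ (a : A) (r : R) (m : M) :
  pure_tensor ((r : R^c) *: a) m = pure_tensor a (r *: m).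
Proof.
apply/eqP; rewrite /pure_tensor -subr_eq0 -raddfB.
exact/eqP/tensor_relator_eq0/TensorZ.
Qed.

Lemma pure_tensorBr (a : A) : zmod_morphism (pure_tensor a : M -> tensor A M).
Proof.
move=> x y; apply/eqP.
by rewrite eq_sym subr_eq -pure_tensorDr subrK.
Qed.

Section TensorCurry.
Variable f : {additive tensor A M -> QmodZ}.

Fact tensor_curry_subproof a : zmod_morphism (fun x => f (pure_tensor a x)).
Proof. by move=> x y; rewrite pure_tensorBr raddfB. Qed.

Fact tensor_curry_linear :
  linear (fun a => additive_pack (tensor_curry_subproof a) : lchar M).
Proof.
move=> r a b; apply: additive_ext => x /=.
by rewrite pure_tensorDl raddfD pure_tensorZ.
Qed.

Definition tensor_curry : {linear A -> lchar M} :=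
  linear_pack tensor_curry_linear.

End TensorCurry.

End PureTensor.

Section FlatCharacter.
Variables (R : pzRingType) (F : lmodType R).

Definition tensor_char (A : lmodType R^c) (h : {linear A -> lchar F}) :
    {additive {freeg (A * F)%type} -> QmodZ} :=
  free_lift (fun k => (h k.1 : {additive F -> QmodZ}) k.2).

(** The pairing [(a, x) |-> h a x] is biadditive and balanced, so it descends to the tensor product.
    Together with [tensor_curry] this is the adjunction between characters of [tensor A F] and
    linear maps from [A] to the character module of [F]. *)
Lemma tensor_char_eq0 (A : lmodType R^c) (h : {linear A -> lchar F}) u :
  \pi_(tensor A F) u = 0 -> tensor_char h u = 0.
Proof.
move=> /eqP; rewrite -[0](raddf0 \pi_(tensor A F)) -Quotient.idealrBE subr0.
pose S : pred _ := fun x => tensor_char h x == 0.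
have Sz : zmod_closed S.
  split=> [|x y]; first by rewrite -topredE /= /S raddf0.
  by rewrite -!topredE /= /S raddfB => /eqP-> /eqP->; rewrite subr0.
pose SC := GRing.isZmodClosed.Build _ S Sz.
pose S' : zmodClosed _ := HB.pack S SC.
rewrite inE => /(_ S') Su; apply/eqP/Su => y hy.
rewrite -topredE /= /S; apply/eqP.
case: hy => [a b m|a m n|a r m]; rewrite raddfB ?raddfD !free_liftE /=.
- by rewrite (raddfD h) -opprD; apply: subrr.
- by rewrite raddfD -opprD subrr.
- by rewrite linearZ_LR subrr.
Qed.

(** By adjunction [h] is a character of [tensor A F]. Flatness makes [tensor A F] a subgroup of
    [tensor B F], so this character extends, and currying the extension extends [h]. *)
Lemma flat_injective_char : flat F -> injective_module (lchar F).
Proof.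
move=> flatF; apply: extend_injective_module => A B i h i_inj.
have [||f fP] := @character_extend (tensor B F)
  (fun p => exists u, p = (tensor_map i F (\pi_(tensor A F) u), tensor_char h u)).
- split; first by exists 0; rewrite tensor_map_pi !raddf0.
  move=> _ _ [u ->] [v ->]; exists (u - v).
  congr pair; last exact/esym/raddfB.
  by rewrite raddfB tensor_map_is_zmod_morphism.
- move=> e [u [/esym iu0 ->]]; apply: tensor_char_eq0; apply: (flatF _ _ i i_inj).
  rewrite iu0; apply/esym.
  exact: (raddf0 (additive_pack (@tensor_map_is_zmod_morphism R A B i F))).
exists (tensor_curry f) => a; apply: additive_ext => x /=.
rewrite -tensor_mapE; apply: fP; exists << (a, x) >>.
by rewrite /tensor_char free_liftE.
Qed.

(** A nonzero [t] in the kernel is detected by a character [chi]. The curried form of [chi] extends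
    along [f], so [chi] factors through [tensor_map f F] and kills [t]. *)
Lemma injective_char_flat : injective_module (lchar F) -> flat F.
Proof.
move=> Finj A B f f_inj.
pose tf : {additive _ -> _} := additive_pack (@tensor_map_is_zmod_morphism R A B f F).
apply: (@raddf_inj _ _ tf) => t tf0.
apply: contrapT => t0.
have [||chi chit _] := @character_separates (tensor A F) (fun x => x = 0) t => //.
  by split=> // x y -> ->; rewrite subr0.
have [g gP] := injective_module_extend (tensor_curry chi) Finj f_inj.
case: chit; rewrite -[t]reprK.
pose chi' : {additive _ -> _} := chi \o \pi_(tensor A F).
pose g' : {additive _ -> _} := tensor_char g \o free_map f (M := F).
have -> : chi (\pi_(tensor A F) (repr t)) = g' (repr t).
  apply: (@free_additive_ext _ _ chi') => -[a x].
  change (chi (pure_tensor a x) = tensor_char g (free_map f << (a, x) >>)).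
  rewrite free_mapE free_liftE /=.
  by have /(congr1 (fun k : lchar F => (k : {additive F -> QmodZ}) x)) /= -> := gP a.
rewrite /g' /=; apply: tensor_char_eq0.
by rewrite -tensor_map_pi reprK.
Qed.

End FlatCharacter.

(** * The equational criterion for flatness *)

Section Fcat.
Variables (T : Type) (m n : nat) (f : 'I_m -> T) (g : 'I_n -> T).

Definition fcat (k : 'I_(m + n)) : T :=
  match split k with inl i => f i | inr j => g j end.

Lemma fcat_lshift i : fcat (lshift n i) = f i.
Proof. by rewrite /fcat -[lshift n i]/(unsplit (inl i)) unsplitK. Qed.

Lemma fcat_rshift j : fcat (rshift m j) = g j.
Proof. by rewrite /fcat -[rshift m j]/(unsplit (inr j)) unsplitK. Qed.

End Fcat.

Lemma is_submodule_comb (R : pzRingType) (B E : lmodType R) (G : B * E -> Prop)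
    n (r : 'I_n -> R) (b : 'I_n -> B) (e : 'I_n -> E) :
  is_submodule G -> (forall i, G (b i, e i)) ->
  G (\sum_i r i *: b i, \sum_i r i *: e i).
Proof.
move=> GS Gbe; apply: (big_ind2 (fun x y => G (x, y))); first by case: GS.
  by move=> x1 x2 y1 y2 Gx Gy; apply: (is_submoduleD GS Gx Gy).
by move=> i _; apply: (is_submoduleZ GS (r i) (Gbe i)).
Qed.

Lemma additive_sumE (U V : zmodType) (I : Type) (s : seq I) (P : pred I)
    (f : I -> {additive U -> V}) x :
  (\sum_(i <- s | P i) f i) x = \sum_(i <- s | P i) f i x.
Proof. by apply: (big_morph (fun g : {additive U -> V} => g x)). Qed.

(* Matrices over R^c act on tuples of a left module by x_i = \sum_j B_ji y_j, so
   B *m a = 0 reads \sum_i a_i B_ji = 0 in R.  For a submodule P the predicate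
   says that F / P satisfies the equational criterion for flatness. *)
Definition flat_modulo (R : pzRingType) (F : lmodType R) (P : F -> Prop) :=
  forall n (a : 'cV[R^c]_n) (x : 'I_n -> F),
    P (\sum_i (a i 0 : R) *: x i) ->
  exists m (B : 'M[R^c]_(m, n)) (y : 'I_m -> F),
    B *m a = 0 /\ forall i, P (x i - \sum_j (B j i : R) *: y j).

Lemma fcat_scale_sum (R : pzRingType) (F : lmodType R) m n
    (a : 'cV[R^c]_m) (b : 'cV[R^c]_n) (x : 'I_m -> F) (y : 'I_n -> F) :
  \sum_i (col_mx a b i 0 : R) *: fcat x y i =
  \sum_i (a i 0 : R) *: x i + \sum_i (b i 0 : R) *: y i.
Proof.
rewrite big_split_ord; congr (_ + _); apply: eq_bigr => i _.
  by rewrite col_mxEu fcat_lshift.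
by rewrite col_mxEd fcat_rshift.
Qed.

Section EquationalCriterion.
Variables (R : pzRingType) (F : lmodType R).

Section RowCharacter.
Variables (n : nat) (chi : {additive {ffun 'I_n -> F} -> QmodZ}).

Fact row_char_subproof (r : 'rV[R^c]_n) :
  zmod_morphism (fun y : F => chi [ffun i => (r 0 i : R) *: y]).
Proof.
move=> x y; rewrite -raddfB; congr (chi _); apply/ffunP => i.
by rewrite !ffunE scalerBr.
Qed.

(** The map from R^n to the character module of [F] that corresponds by adjunction to [chi], seen as
    a character of the tensor product of R^n with [F]. *)
Definition row_char (r : 'rV[R^c]_n) : lchar F := additive_pack (row_char_subproof r).

End RowCharacter.

(** If the tuple [x] is not in the subgroup [H] of tuples solved by some [B] and [y], a character
    [chi] separates it from [H]. Then [r *m a |-> row_char chi r] is well defined, and by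
    injectivity it is given by a single character [g 1] of [F]. Hence [chi] takes at [x] the value
    of [g 1] at the zero sum of the [a_i x_i], a contradiction. *)
Lemma injective_char_flat_modulo0 :
  injective_module (lchar F) -> flat_modulo (fun x : F => x = 0).
Proof.
move=> Finj n a x ax0.
pose H (v : {ffun 'I_n -> F}) := exists m (B : 'M[R^c]_(m, n)) (y : 'I_m -> F),
  B *m a = 0 /\ forall i, v i - \sum_j (B j i : R) *: y j = 0.
suff [m [B [y [Ba xy]]]] : H (finfun x).
  by exists m, B, y; split=> // i; rewrite -[RHS](xy i) ffunE.
apply: contrapT => Hx.
have [||chi chix chiH] := @character_separates _ H (finfun x) => //.
  split=> [|v v' [m [B [y [Ba vy]]]] [m' [B' [y' [Ba' vy']]]]].
    exists 0%N, 0, (fun=> 0); split=> [|i]; first by rewrite mul0mx.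
    by rewrite big_ord0 ffunE subr0.
  exists (m + m')%N, (col_mx B B'), (fcat y (fun j => - y' j)).
  split=> [|i]; first by rewrite mul_col_mx Ba Ba' col_mx0.
  have -> : \sum_j (col_mx B B' j i : R) *: fcat y (fun j => - y' j) j =
    \sum_j (B j i : R) *: y j - \sum_j (B' j i : R) *: y' j.
    rewrite big_split_ord -sumrN; congr (_ + _); apply: eq_bigr => j _.
      by rewrite col_mxEu fcat_lshift.
    by rewrite col_mxEd fcat_rshift scalerN.
  by rewrite !ffunE opprD addrACA vy add0r -opprD vy' oppr0.
pose G (p : (R^c)^o * lchar F) :=
  exists r : 'rV[R^c]_n, p = ((r *m a) 0 0, row_char chi r).
have GP : partial_linear G.
  split; first split.
  - exists 0; rewrite mul0mx mxE; congr pair; apply: additive_ext => y /=.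
    rewrite -(raddf0 chi); congr (chi _); apply/ffunP => i.
    by rewrite !ffunE mxE scale0r.
  - move=> c _ _ [r ->] [r' ->]; exists (c *: r + r').
    congr pair; first by rewrite mulmxDl -scalemxAl !mxE.
    apply: additive_ext => y /=; rewrite -raddfD; congr (chi _).
    by apply/ffunP => i; rewrite !ffunE !mxE scalerDl scalerA.
  (* If [r *m a = 0], the row [r] itself serves as a matrix [B] with one row, so the tuple of the
     [r_i y] lies in [H]. *)
  - move=> e [r [/esym ra0 ->]]; apply: additive_ext => y /=.
    apply: chiH; exists 1%N, r, (fun=> y); split.
      by apply/matrixP => i j; rewrite !ord1 ra0 mxE.
    by move=> i; rewrite big_ord1 ffunE subrr.
have [g gP] := Finj _ G GP.
case: chix.
have gE i : row_char chi (delta_mx 0 i) = (a i 0 : R^c) *: g 1.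
  rewrite -linearZ; apply/esym/gP; exists (delta_mx 0 i).
  by congr pair; rewrite -rowE mxE [LHS]mulr1.
transitivity (\sum_i (row_char chi (delta_mx 0 i) : {additive F -> QmodZ}) (x i)).
  rewrite /= -raddf_sum; congr (chi _); apply/ffunP => k.
  rewrite sum_ffunE ffunE (bigD1 k) //= big1 => [|i /negbTE ik].
    by rewrite ffunE mxE !eqxx scale1r addr0.
  by rewrite ffunE mxE eq_sym ik andbF scale0r.
under eq_bigr do rewrite gE.
by rewrite /= -raddf_sum ax0 raddf0.
Qed.

(** Baer's criterion: a partial map on a right ideal, sending [a_i] to [h_i], induces on sums of the
    [a_i x_i] the map with value the sum of the [h_i x_i]. Its graph is [K], and any extension [psi]
    of it to [F] represents the partial map. *)
Lemma flat_modulo0_injective_char :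
  flat_modulo (fun x : F => x = 0) -> injective_module (lchar F).
Proof.
move=> Fflat; apply: baer_criterion => G GP; have [GS G0] := GP.
pose K (p : F * QmodZ) := exists n (a : 'cV[R^c]_n)
  (h : 'I_n -> lchar F) (x : 'I_n -> F), (forall i, G (a i 0, h i)) /\
  p = (\sum_i (a i 0 : R) *: x i, \sum_i (h i : {additive F -> QmodZ}) (x i)).
have [||psi psiP] := @character_extend F K.
- split=> [|_ _ [m [a [h [x [Gh ->]]]]] [n [b [k [y [Gk ->]]]]]].
    exists 0%N, 0, (fun=> 0), (fun=> 0); split; first by case.
    by rewrite !big_ord0.
  exists (m + n)%N, (col_mx a b), (fcat h k), (fcat x (fun i => - y i)); split.
    move=> i; case: (split_ordP i) => j ->.
      by rewrite col_mxEu fcat_lshift.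
    by rewrite col_mxEd fcat_rshift.
  congr pair => /=.
    rewrite fcat_scale_sum -sumrN; congr (_ + _); apply: eq_bigr => i _.
    by rewrite scalerN.
  rewrite big_split_ord -sumrN; congr (_ + _); apply: eq_bigr => i _.
    by rewrite !fcat_lshift.
  by rewrite !fcat_rshift raddfN.
(* Substituting [x_i = \sum_j B_ji y_j] turns the value into the sum over [j] of
   [(\sum_i B_ji h_i) y_j], and each inner sum is the image of [\sum_i B_ji a_i = 0]. *)
- move=> e [n [a [h [x [Gh [/esym ax0 ->]]]]]].
  have [m [B [y [Ba xy]]]] := Fflat _ _ _ ax0.
  under eq_bigr => i _.
    move/eqP: (xy i); rewrite subr_eq0 => /eqP ->; rewrite raddf_sum.
    over.
  rewrite exchange_big big1 // => j _ /=.
  have Gj : G (0, \sum_i (B j i : R^c) *: h i).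
    have -> : 0 = \sum_i (B j i : R^c) *: (a i 0 : (R^c)^o).
      by have /matrixP/(_ j 0) := Ba; rewrite !mxE.
    exact: is_submodule_comb.
  have /(congr1 (fun f : lchar F => (f : {additive F -> QmodZ}) (y j))) := G0 _ Gj.
  by rewrite additive_sumE.
exists psi => s e Ge; apply: additive_ext => x /=; apply/esym/psiP.
exists 1%N, (const_mx s), (fun=> e), (fun=> x).
by rewrite !big_ord1 mxE; split=> // i; rewrite mxE.
Qed.

End EquationalCriterion.

(** * Quotient modules *)

Section QuotientModule.
Variables (R : pzRingType) (V : lmodType R) (P : V -> Prop).
Hypothesis PS : is_submodule P.

(** The proof that [P] is a submodule is an argument so that the closure instance below can depend
    on it. *)
Definition submodule_pred of is_submodule P : {pred V} := [pred x | `[< P x >]].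

Fact submodule_pred_closed : zmod_closed (submodule_pred PS).
Proof.
split=> [|x y]; first by rewrite inE; case: PS.
by rewrite !inE; apply: is_submoduleB.
Qed.

HB.instance Definition _ :=
  GRing.isZmodClosed.Build V (submodule_pred PS) submodule_pred_closed.

Definition quotient_module : Type := Quotient.quot (submodule_pred PS).

HB.instance Definition _ :=
  GRing.Zmodule.copy quotient_module (Quotient.quot (submodule_pred PS)).

Let quo (v : V) : quotient_module := \pi_(Quotient.quot (submodule_pred PS)) v.

Let quo_eq x y : P (x - y) -> quo x = quo y.
Proof.
by move=> Pxy; apply/eqP; rewrite /quo -Quotient.idealrBE inE.
Qed.

Let eq_quo x y : quo x = quo y -> P (x - y).
Proof.
by move=> /eqP; rewrite /quo -Quotient.idealrBE inE.
Qed.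

Let rep (t : quotient_module) : V := repr (t : Quotient.quot (submodule_pred PS)).

Let quo_rep t : quo (rep t) = t.
Proof. exact: (@reprK _ (Quotient.quot (submodule_pred PS))). Qed.

Let quoD x y : quo (x + y) = quo x + quo y.
Proof. exact: raddfD. Qed.

Definition quotient_scale (r : R) (t : quotient_module) : quotient_module :=
  quo (r *: rep t).

Let quo_scale r x : quotient_scale r (quo x) = quo (r *: x).
Proof.
apply: quo_eq; rewrite -scalerBr; apply: is_submoduleZ => //.
by apply: eq_quo; rewrite quo_rep.
Qed.

Fact quotient_scaleA r s t :
  quotient_scale r (quotient_scale s t) = quotient_scale (r * s) t.
Proof. by rewrite -[t]quo_rep !quo_scale scalerA. Qed.

Fact quotient_scale1 : left_id 1 quotient_scale.
Proof. by move=> t; rewrite -[t]quo_rep quo_scale scale1r. Qed.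

Fact quotient_scaleDr : right_distributive quotient_scale +%R.
Proof.
move=> r t u; rewrite -[t]quo_rep -[u]quo_rep !quo_scale -!quoD quo_scale.
by rewrite scalerDr.
Qed.

Fact quotient_scaleDl t : {morph quotient_scale^~ t : r s / r + s}.
Proof. by move=> r s; rewrite -[t]quo_rep !quo_scale -quoD scalerDl. Qed.

HB.instance Definition _ := GRing.Zmodule_isLmodule.Build R quotient_module
  quotient_scaleA quotient_scale1 quotient_scaleDr quotient_scaleDl.

Fact quotient_proj_linear : linear quo.
Proof. by move=> r x y; rewrite quoD -quo_scale. Qed.

Definition quotient_proj : {linear V -> quotient_module} :=
  linear_pack quotient_proj_linear.

Lemma quotient_proj_eq0 x : quotient_proj x = 0 <-> P x.
Proof.
split=> [x0|Px].
  by rewrite -[x]subr0; apply: eq_quo; rewrite [LHS]x0; apply/esym/raddf0.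
by rewrite -(raddf0 quotient_proj); apply: quo_eq; rewrite subr0.
Qed.

Lemma quotient_proj_surj t : exists x, quotient_proj x = t.
Proof. by exists (rep t); apply: quo_rep. Qed.

End QuotientModule.

Lemma surjective_factor (R : pzRingType) (V Q W : lmodType R)
    (p : {linear V -> Q}) (f : {linear V -> W}) :
  (forall q, exists v, p v = q) -> (forall v, p v = 0 -> f v = 0) ->
  exists g : {linear Q -> W}, forall v, g (p v) = f v.
Proof.
move=> p_surj pf; have [s sP] := choice p_surj.
have fs x y : p x = p y -> f x = f y.
  move=> pxy; apply/eqP; rewrite -subr_eq0 -linearB; apply/eqP/pf.
  by rewrite linearB pxy subrr.
have gL : linear (f \o s).
  by move=> r x y /=; rewrite -linearP; apply: fs; rewrite linearP !sP.
by exists (linear_pack gL) => v; apply: fs.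
Qed.

(** Tuples of [Q] lift along a set-theoretic section of [p], and equations in [Q] become membership
    in [P], so the two equational criteria agree. *)
Lemma surjective_flat (R : pzRingType) (V Q : lmodType R) (p : {linear V -> Q})
    (P : V -> Prop) :
  (forall q, exists v, p v = q) -> (forall v, p v = 0 <-> P v) ->
  flat_modulo P <-> flat Q.
Proof.
move=> p_surj pP; have [s sP] := choice p_surj; split=> [VP|Qflat].
  apply/injective_char_flat/flat_modulo0_injective_char => n a x ax0.
  have [|m [B [y [Ba xy]]]] := VP n a (s \o x).
    apply/pP; rewrite linear_sum -[RHS]ax0; apply: eq_bigr => i _.
    by rewrite linearZ /= sP.
  exists m, B, (p \o y); split=> // i.
  have -> : \sum_j (B j i : R) *: (p \o y) j = p (\sum_j (B j i : R) *: y j).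
    by rewrite linear_sum; apply: eq_bigr => j _; rewrite linearZ.
  by rewrite -[x i]sP -linearB; apply/pP/xy.
have {}Qflat := injective_char_flat_modulo0 (flat_injective_char Qflat).
move=> n a x /pP ax0; have [|m [B [y [Ba xy]]]] := Qflat n a (p \o x).
  by rewrite -[RHS]ax0 linear_sum; apply: eq_bigr => i _; rewrite linearZ.
exists m, B, (s \o y); split=> // i; apply/pP; rewrite -[RHS](xy i).
rewrite linearB linear_sum; congr (_ - _).
by apply: eq_bigr => j _; rewrite linearZ /= sP.
Qed.

(** * Direct sums *)

Section DirectSum.
Variables (R : pzRingType) (I : Type) (F : I -> lmodType R).

(** Equality and choice are taken from the classical axioms because [I] is an arbitrary type, while
    [freeg] needs a choice type. *)
Definition dsum_base : Type := {i : I & F i}.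
HB.instance Definition _ := gen_eqMixin dsum_base.
HB.instance Definition _ := gen_choiceMixin dsum_base.

Let dlift (V : zmodType) (f : forall i, {additive F i -> V}) :
    {additive {freeg dsum_base} -> V} :=
  free_lift (fun t : dsum_base => f (tag t) (tagged t)).

(* The direct sum is the quotient of the free abelian group on the disjoint
   union of the F i by the elements that every additive family kills. *)
Definition dsum_rel : {pred {freeg dsum_base}} :=
  [pred u | `[< forall (V : zmodType) (f : forall i, {additive F i -> V}),
                  dlift f u = 0 >]].

Fact dsum_rel_closed : zmod_closed dsum_rel.
Proof.
split=> [|x y]; first by rewrite inE => V f; rewrite raddf0.
by rewrite !inE => dx dy V f; rewrite raddfB dx dy subr0.
Qed.

HB.instance Definition _ :=
  GRing.isZmodClosed.Build {freeg dsum_base} dsum_rel dsum_rel_closed.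

Definition dsum : Type := Quotient.quot dsum_rel.
HB.instance Definition _ := GRing.Zmodule.copy dsum (Quotient.quot dsum_rel).

Let quo (u : {freeg dsum_base}) : dsum := \pi_(Quotient.quot dsum_rel) u.
Let rep (t : dsum) : {freeg dsum_base} := repr (t : Quotient.quot dsum_rel).

Let quo_rep t : quo (rep t) = t.
Proof. exact: (@reprK _ (Quotient.quot dsum_rel)). Qed.

Let quoB u v : quo (u - v) = quo u - quo v.
Proof. exact: raddfB. Qed.

Let quo_eq u v :
  (forall (V : zmodType) (f : forall i, {additive F i -> V}), dlift f u = dlift f v) ->
  quo u = quo v.
Proof.
move=> uv; apply/eqP; rewrite /quo -Quotient.idealrBE inE => V f.
by rewrite raddfB uv subrr.
Qed.

Let eq_quo u v (V : zmodType) (f : forall i, {additive F i -> V}) :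
  quo u = quo v -> dlift f u = dlift f v.
Proof.
move=> /eqP; rewrite /quo -Quotient.idealrBE inE => /(_ V f) /eqP.
by rewrite raddfB subr_eq0 => /eqP.
Qed.

Section Lift.
Variables (V : zmodType) (f : forall i, {additive F i -> V}).

Fact dsum_lift_subproof : zmod_morphism (fun t => dlift f (rep t)).
Proof.
by move=> t u; rewrite -raddfB; apply: eq_quo; rewrite quoB !quo_rep.
Qed.

Definition dsum_lift : {additive dsum -> V} := additive_pack dsum_lift_subproof.

End Lift.

Let dinj i (x : F i) : {freeg dsum_base} := << (Tagged F x : dsum_base) >>.

Let dlift_dinj (V : zmodType) (f : forall i, {additive F i -> V}) i (x : F i) :
  dlift f (dinj x) = f i x.
Proof. by rewrite /dlift free_liftE. Qed.

Let dscale r : {additive {freeg dsum_base} -> {freeg dsum_base}} :=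
  free_lift (fun t : dsum_base => dinj (r *: tagged t)).

Let fscale (r : R) (V : zmodType) (f : forall i, {additive F i -> V}) i :
  {additive F i -> V} := f i \o *:%R r.

(** Scaling is absorbed into the test family; hence it respects [dsum_rel], and the module axioms
    reduce to identities between families. *)
Let dlift_dscale r (V : zmodType) (f : forall i, {additive F i -> V}) u :
  dlift f (dscale r u) = dlift (fscale r f) u.
Proof.
apply: (@free_additive_ext _ _ (dlift f \o dscale r)) => -[i x].
rewrite -[LHS]/(dlift f (dscale r (dinj x))) -[RHS]/(dlift (fscale r f) (dinj x)).
by rewrite [dscale r _]free_liftE !dlift_dinj.
Qed.

Definition dsum_scale (r : R) (t : dsum) : dsum := quo (dscale r (rep t)).

Let quo_scale r u : dsum_scale r (quo u) = quo (dscale r u).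
Proof.
by apply: quo_eq => V f; rewrite !dlift_dscale; apply: eq_quo; rewrite quo_rep.
Qed.


Let dlift_add (V : zmodType) (f g h : forall i, {additive F i -> V}) u :
  (forall i x, f i x = g i x + h i x) -> dlift f u = dlift g u + dlift h u.
Proof.
move=> fgh; pose gh : {additive _ -> _} := dlift g \+ dlift h.
apply: (@free_additive_ext _ _ _ gh) => -[i x].
rewrite -[LHS]/(dlift f (dinj x)) -[RHS]/(dlift g (dinj x) + dlift h (dinj x)).
by rewrite !dlift_dinj.
Qed.

Let dlift_ext (V : zmodType) (f g : forall i, {additive F i -> V}) u :
  (forall i x, f i x = g i x) -> dlift f u = dlift g u.
Proof.
move=> fg; apply: free_additive_ext => -[i x].
by rewrite -[LHS]/(dlift f (dinj x)) -[RHS]/(dlift g (dinj x)) !dlift_dinj.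
Qed.

Fact dsum_scaleA r s t : dsum_scale r (dsum_scale s t) = dsum_scale (r * s) t.
Proof.
rewrite -[t]quo_rep !quo_scale; apply: quo_eq => V f; rewrite !dlift_dscale.
by apply: dlift_ext => i x; rewrite /fscale /= scalerA.
Qed.

Fact dsum_scale1 : left_id 1 dsum_scale.
Proof.
move=> t; rewrite -[t]quo_rep !quo_scale; apply: quo_eq => V f.
by rewrite dlift_dscale; apply: dlift_ext => i x; rewrite /fscale /= scale1r.
Qed.

Let quoD u v : quo (u + v) = quo u + quo v.
Proof. exact: raddfD. Qed.

Fact dsum_scaleDr : right_distributive dsum_scale +%R.
Proof.
move=> r t u; rewrite -[t]quo_rep -[u]quo_rep !quo_scale -!quoD quo_scale.
by rewrite raddfD.
Qed.

Fact dsum_scaleDl t : {morph dsum_scale^~ t : r s / r + s}.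
Proof.
move=> r s; rewrite -[t]quo_rep !quo_scale -quoD; apply: quo_eq => V f.
rewrite raddfD !dlift_dscale; apply: dlift_add => i x.
by rewrite /fscale /= scalerDl raddfD.
Qed.

HB.instance Definition _ := GRing.Zmodule_isLmodule.Build R dsum
  dsum_scaleA dsum_scale1 dsum_scaleDr dsum_scaleDl.

Fact dsum_inj_linear i : linear (fun x : F i => quo (dinj x)).
Proof.
move=> r x y; have -> : r *: quo (dinj x) = quo (dscale r (dinj x)).
  exact: quo_scale.
rewrite -quoD; apply: quo_eq => V f.
by rewrite raddfD dlift_dscale !dlift_dinj raddfD.
Qed.

Definition dsum_inj i : {linear F i -> dsum} := linear_pack (@dsum_inj_linear i).

Lemma dsum_lift_inj (V : zmodType) (f : forall i, {additive F i -> V}) i (x : F i) :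
  dsum_lift f (dsum_inj i x) = f i x.
Proof. by rewrite -[RHS]dlift_dinj; apply: eq_quo; rewrite quo_rep. Qed.

Lemma dsum_additive_ext (V : zmodType) (f g : {additive dsum -> V}) :
  (forall i x, f (dsum_inj i x) = g (dsum_inj i x)) -> f =1 g.
Proof.
move=> fg t; pose q : {additive _ -> dsum} := additive_pack quoB.
rewrite -[t]quo_rep.
by apply: (@free_additive_ext _ _ (f \o q) (g \o q)) => -[i x]; apply: fg.
Qed.

Fact dsum_lift_linear (V : lmodType R) (f : forall i, {linear F i -> V}) :
  linear (dsum_lift f).
Proof.
move=> r x y; rewrite raddfD; congr (_ + _).
pose g : {additive dsum -> V} := dsum_lift f \o *:%R r.
pose h : {additive dsum -> V} := *:%R r \o dsum_lift f.
apply: (@dsum_additive_ext _ g h) => i {}x.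
rewrite -[LHS]/(dsum_lift f (r *: dsum_inj i x)).
rewrite -[RHS]/(r *: dsum_lift f (dsum_inj i x)) -linearZ_LR !dsum_lift_inj.
exact: linearZ_LR.
Qed.

Definition dsum_llift (V : lmodType R) (f : forall i, {linear F i -> V}) :
  {linear dsum -> V} := linear_pack (dsum_lift_linear f).

Lemma dsum_llift_inj (V : lmodType R) (f : forall i, {linear F i -> V}) i x :
  dsum_llift f (dsum_inj i x) = f i x.
Proof. exact: dsum_lift_inj. Qed.

(** The character module of a direct sum is the product of the character modules, and a product of
    injectives is injective: extensions are chosen componentwise and glued by [dsum_lift]. *)
Lemma dsum_flat : (forall i, flat (F i)) -> flat dsum.
Proof.
move=> Fflat; apply: injective_char_flat; apply: extend_injective_module.
move=> A B j h j_inj.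
have hL i : linear (fun a => (h a : {additive dsum -> QmodZ}) \o dsum_inj i : lchar (F i)).
  move=> r a b; apply: additive_ext => x.
  rewrite -[LHS]/((h (r *: a + b) : {additive dsum -> QmodZ}) (dsum_inj i x)).
  rewrite -[RHS]/((h a : {additive dsum -> QmodZ}) (dsum_inj i ((r : R) *: x)) +
                  (h b : {additive dsum -> QmodZ}) (dsum_inj i x)).
  by rewrite linearP linearZ_LR.
have gex i := cid (injective_module_extend (linear_pack (@hL i))
  (flat_injective_char (Fflat i)) j_inj).
pose g i : {linear B -> lchar (F i)} := sval (gex i).
have gP i : g i \o j =1 linear_pack (@hL i) := svalP (gex i).
pose G b : {additive dsum -> QmodZ} := dsum_lift (fun i => g i b : {additive F i -> QmodZ}).
have GL : linear (G : B -> lchar dsum).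
  move=> r a b; apply: additive_ext; apply: dsum_additive_ext => i x.
  rewrite -[LHS]/(G (r *: a + b) (dsum_inj i x)).
  rewrite -[RHS]/(G a ((r : R) *: (dsum_inj i x : dsum)) + G b (dsum_inj i x)).
  by rewrite -linearZ_LR !dsum_lift_inj linearP.
exists (linear_pack GL) => a; apply: additive_ext; apply: dsum_additive_ext => i x.
rewrite -[LHS]/(G (j a) (dsum_inj i x)) dsum_lift_inj.
by have /(congr1 (fun f : lchar (F i) => (f : {additive F i -> QmodZ}) x)) := gP i a.
Qed.

End DirectSum.

(** * Flat precovers *)

(** Writing [x_i = x_i * 1] solves the equational criterion, with the row of the [x_i] as [B]. *)
Lemma regular_flat (R : pzRingType) : flat (R^o : lmodType R).
Proof.
apply/injective_char_flat/flat_modulo0_injective_char => n a x ax0.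
exists 1%N, (\row_i (x i : R^c)), (fun=> 1); split.
  apply/matrixP => i j; rewrite !ord1 !mxE -[RHS]ax0; apply: eq_bigr => k _.
  by rewrite mxE.
by move=> i; rewrite big_ord1 mxE [_ *: _]mulr1 subrr.
Qed.

(* Names for the elements of the smallest submodule of F that contains a given
   element and is closed under solving single equations modulo A. *)
Inductive pure_term (R : Type) : Type :=
| PureRoot
| PureLin of R & pure_term R & pure_term R
| PureSol n of 'I_n -> R & pure_term R & 'I_n.

Section PureClosure.
Variables (R : pzRingType) (F : lmodType R) (A : F -> Prop) (y0 : F).

Definition solve n (a : 'I_n -> R) (p : F) : 'I_n -> F :=
  if pselect (exists x : 'I_n -> F, A (\sum_i a i *: x i - p)) is left ex
  then sval (cid ex) else fun=> 0.

Fixpoint pure_eval (t : pure_term R) : F :=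
  match t with
  | PureRoot => y0
  | PureLin r t u => r *: pure_eval t + pure_eval u
  | PureSol n a p j => solve a (pure_eval p) j
  end.

Lemma pure_eval_solve n (a : 'I_n -> R) (p : pure_term R) (x : 'I_n -> F) :
  A (\sum_i a i *: x i - pure_eval p) ->
  A (\sum_i a i *: pure_eval (PureSol a p i) - pure_eval p).
Proof.
move=> Ax; rewrite /= /solve; case: pselect => [ex|[]]; last by exists x.
exact: (svalP (cid ex)).
Qed.

End PureClosure.

(* Names for the elements of a submodule of F that realizes every X-indexed
   diagram (values nu in N, linear relations T, parameters c on X0) realized in
   F with parameters in that submodule. *)
Inductive skolem_term (R N X : Type) : Type :=
| SkolemZero
| SkolemLin of R & skolem_term R N X & skolem_term R N X
| SkolemNode (nu : X -> N) (T : R -> X -> X -> X -> Prop) (X0 : X -> Prop)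
    (c : X -> skolem_term R N X) (x : X).

Section SkolemHull.
Variables (R : pzRingType) (F N : lmodType R) (phi : {linear F -> N}) (X : Type).

Definition realizes (nu : X -> N) (T : R -> X -> X -> X -> Prop)
    (X0 : X -> Prop) (c : X -> F) (rho : X -> F) :=
  [/\ forall x, phi (rho x) = nu x,
      forall r x y z, T r x y z -> rho z = r *: rho x + rho y &
      forall x, X0 x -> rho x = c x].

Definition realize nu T X0 c : X -> F :=
  if pselect (exists rho, realizes nu T X0 c rho) is left ex
  then sval (cid ex) else fun=> 0.

Lemma realizeP nu T X0 c rho :
  realizes nu T X0 c rho -> realizes nu T X0 c (realize nu T X0 c).
Proof.
move=> rhoP; rewrite /realize; case: pselect => [ex|[]]; last by exists rho.
exact: (svalP (cid ex)).
Qed.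

Fixpoint skolem_eval (w : skolem_term R N X) : F :=
  match w with
  | SkolemZero => 0
  | SkolemLin r w w' => r *: skolem_eval w + skolem_eval w'
  | SkolemNode nu T X0 c x => realize nu T X0 (fun y => skolem_eval (c y)) x
  end.

Definition skolem_hull (y : F) := exists w, skolem_eval w = y.

Lemma skolem_hull_submodule : is_submodule skolem_hull.
Proof.
split=> [|r x y [w <-] [w' <-]]; first by exists (SkolemZero R N X).
by exists (SkolemLin r w w').
Qed.

(** The family [e] itself realizes the diagram recording its values under [phi], all its linear
    relations and its members in the hull. So the realization chosen for that diagram is a genuine
    one, and [SkolemNode] names its elements. *)
Lemma skolem_hull_copy (e : X -> F) : exists e' : X -> F,
  [/\ forall x, skolem_hull (e' x),
      forall x, phi (e' x) = phi (e x),
      forall r x y z, e z = r *: e x + e y -> e' z = r *: e' x + e' y &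
      forall x, skolem_hull (e x) -> e' x = e x].
Proof.
have /choice[c cP] x : exists w, skolem_hull (e x) -> skolem_eval w = e x.
  have [[w wx]|nx] := pselect (skolem_hull (e x)); first by exists w.
  by exists (SkolemZero R N X).
pose nu x := phi (e x).
pose T r x y z := e z = r *: e x + e y.
pose X0 x := skolem_hull (e x).
have /realizeP[e1 e2 e3] : realizes nu T X0 (fun x => skolem_eval (c x)) e.
  by split=> // x /cP.
exists (realize nu T X0 (fun x => skolem_eval (c x))); split=> //.
  by move=> x; exists (SkolemNode nu T X0 c x).
by move=> x Ax; rewrite e3 ?cP.
Qed.

End SkolemHull.

Definition kernel_reduced (R : pzRingType) (F N : lmodType R) (phi : {linear F -> N}) :=
  forall Q : F -> Prop, is_submodule Q -> flat_modulo Q ->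
  (forall x, Q x -> phi x = 0) -> forall x, Q x -> x = 0.

(* If y0 lies outside the hull A, let P be the pure closure of y0 modulo A and
   theta : P -> A a copy of P fixing P :&: A.  Then (1 - theta) P is a nonzero
   submodule of the kernel of phi, and F modulo it is still flat. *)
Lemma reduced_skolem_hull (R : pzRingType) (F N : lmodType R)
    (phi : {linear F -> N}) :
  flat F -> kernel_reduced phi -> forall y0, skolem_hull phi (pure_term R) y0.
Proof.
move=> Fflat phi_red y0; pose A := skolem_hull phi (pure_term R).
have AS : is_submodule A := skolem_hull_submodule _ _.
pose e := pure_eval A y0.
have [e' [e'A e'phi e'lin e'id]] := skolem_hull_copy phi e.
pose Q x := exists t, x = e t - e' t.
have eL r t u : e (PureLin r t u) = r *: e t + e u by [].
have QS : is_submodule Q.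
  split=> [|r _ _ [t ->] [u ->]].
    (* There is no name for zero; this one evaluates to [- y0 + y0]. *)
    exists (PureLin (-1) (PureRoot R) (PureRoot R)).
    by rewrite eL (e'lin _ _ _ _ (eL _ _ _)) !scaleN1r !addNr subrr.
  exists (PureLin r t u); rewrite eL (e'lin _ _ _ _ (eL _ _ _)).
  by rewrite scalerBr opprD addrACA.
have e'sum n (r : 'I_n -> R) (t : 'I_n -> pure_term R) : exists u,
    e u = \sum_i r i *: e (t i) /\ e' u = \sum_i r i *: e' (t i).
  elim: n r t => [|n IH] r t.
    exists (PureLin (-1) (PureRoot R) (PureRoot R)).
    by rewrite eL (e'lin _ _ _ _ (eL _ _ _)) !scaleN1r !addNr !big_ord0.
  have [u [eu e'u]] := IH (fun i => r (fintype.lift ord0 i)) (fun i => t (fintype.lift ord0 i)).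
  exists (PureLin (r ord0) (t ord0) u).
  by rewrite eL (e'lin _ _ _ _ (eL _ _ _)) !big_ord_recl eu e'u.
have Qflat : flat_modulo Q.
  move=> n a x [p ax].
  (* Modulo [A] the tuple [x] solves the equation with right-hand side [e p], since [e' p] is in
     [A]; so the pure closure contains a solution [e (q i)] modulo [A]. *)
  pose q i := PureSol (fun i => a i 0 : R) p i.
  have /pure_eval_solve Aq : A (\sum_i (a i 0 : R) *: x i - e p).
    by rewrite ax addrC addKr; apply: (is_submoduleN AS (e'A p)).
  have [u [eu e'u]] := e'sum n (fun i => a i 0) q.
  (* The element [e u - e p] lies in [A], hence equals its copy. Therefore
     [e u - e' u = e p - e' p], and subtracting [e (q i) - e' (q i)] from [x i] makes the equation
     homogeneous, where flatness of [F] applies. *)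
  have fix_u : e' (PureLin (-1) p u) = e (PureLin (-1) p u).
    by apply: e'id; rewrite eL eu scaleN1r addrC.
  have ax0 : \sum_i (a i 0 : R) *: (x i - (e (q i) - e' (q i))) = 0.
    under eq_bigr do rewrite scalerBr.
    rewrite sumrB ax; under [X in _ - X]eq_bigr do rewrite scalerBr.
    rewrite sumrB -eu -e'u; move: fix_u.
    rewrite (e'lin _ _ _ _ (eL _ _ _)) eL !scaleN1r => eqpu.
    apply/eqP; rewrite subr_eq0; apply/eqP.
    have := congr1 (fun z => e p + z - e' u) eqpu.
    by rewrite !addrA addrK subrr add0r.
  have /injective_char_flat_modulo0 F0 := flat_injective_char Fflat.
  have [m [B [y [Ba xy]]]] := F0 _ _ _ ax0.
  exists m, B, y; split=> // i; exists (q i).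
  by have /eqP := xy i; rewrite addrAC subr_eq0 => /eqP.
(* The copy has the same values under [phi], so [Q] lies in the kernel and vanishes; thus [y0]
   equals its copy, which is in the hull. *)
have : y0 - e' (PureRoot R) = 0.
  apply: (phi_red Q) => //; last by exists (PureRoot R).
  by move=> _ [t ->]; rewrite linearB e'phi subrr.
by move=> /eqP; rewrite subr_eq0 => /eqP ->; apply: e'A.
Qed.

(** * Factoring a map from a flat module through a kernel-reduced one *)

Section Reduction.
Variables (R : pzRingType) (F N : lmodType R) (phi : {linear F -> N}).
Hypothesis Fflat : flat F.

Definition reducing (P : F -> Prop) :=
  [/\ is_submodule P, flat_modulo P & forall x, P x -> phi x = 0].

Lemma maximal_reducing : exists P, reducing P /\
  forall Q, reducing Q -> (forall x, P x -> Q x) -> forall x, Q x -> P x.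
Proof.
(* Adding 0 makes the union of the empty chain the zero submodule, which is reducing because [F] is
   flat. *)
pose D (A : set F) : F -> Prop := fun x => A x \/ x = 0.
have red0 : reducing (fun x => x = 0).
  split; first by split=> // r x y -> ->; rewrite scaler0 addr0.
    exact: (injective_char_flat_modulo0 (flat_injective_char Fflat)).
  by move=> x ->; rewrite linear0.
have [C Cred Ctot|A [Ared Amax]] := @Zorn_bigcup F (fun A => reducing (D A)).
  have [[A0 CA0]|C0] := pselect (exists A, C A); last first.
    suff -> : D (\bigcup_(X in C) X)%classic = (fun x => x = 0) by [].
    apply/funext => x; apply/propext; split; last by right.
    by case=> // -[A CA _]; case: C0; exists A.
  have in1 x : D (\bigcup_(X in C) X)%classic x -> exists2 A, C A & D A x.
    by case=> [[A CA Ax]|x0]; [exists A => //; left|exists A0 => //; right].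
  have in1' A x : C A -> D A x -> D (\bigcup_(X in C) X)%classic x.
    by move=> CA [Ax|x0]; [left; exists A|right].
  split; first split.
  - by right.
  - move=> r x y /in1[A CA Ax] /in1[A' CA' Ay].
    wlog [E CE [Ex Ey]] : / exists2 E, C E & D E x /\ D E y.
      apply; case: (Ctot _ _ CA CA') => AA'; [exists A'|exists A] => //; split => //.
        by case: Ax => [/AA'|]; [left|right].
      by case: Ay => [/AA'|]; [left|right].
    have [[_ ES] _ _] := Cred _ CE.
    exact: in1' CE (ES _ _ _ Ex Ey).
  (* The criterion assumes a single membership, so one member of the chain already supplies [B] and
     [y]. *)
  - move=> n a x /in1[A CA Ax]; have [_ Aflat _] := Cred _ CA.
    have [m [B [y [Ba xy]]]] := Aflat _ _ _ Ax.
    by exists m, B, y; split=> // i; apply: in1' CA (xy i).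
  - by move=> x /in1[A CA Ax]; have [_ _] := Cred _ CA; apply.
exists (D A); split=> // Q Qred AQ x Qx.
apply: contrapT => nAx; apply: (Amax Q).
  split; first by move=> z Az; apply: AQ; left.
  by move=> QA; apply: nAx; left; apply: QA.
suff -> : D Q = Q by [].
apply/funext => z; apply/propext; split; last by left.
by case=> // ->; have [[]] := Qred.
Qed.

(** Take the quotient by a maximal reducing [P]. A submodule [Q] of the new kernel with flat
    quotient pulls back to a reducing submodule containing [P], so it is zero. *)
Lemma flat_factors_reduced : exists (F' : lmodType R) (p : {linear F -> F'})
  (phi' : {linear F' -> N}), [/\ flat F', kernel_reduced phi' & phi' \o p =1 phi].
Proof.
have [P [[PS Pflat Pphi] Pmax]] := maximal_reducing.
have [p p_surj pP] : exists2 p : {linear F -> quotient_module PS},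
    forall q, exists v, p v = q & forall v, p v = 0 <-> P v.
  exists (quotient_proj PS); first exact: quotient_proj_surj.
  exact: quotient_proj_eq0.
have [phi' phi'P] := surjective_factor (p := p) (f := phi) p_surj
  (fun v pv => Pphi v ((pP v).1 pv)).
exists (quotient_module PS), p, phi'; split=> //.
  exact/(surjective_flat p_surj pP).
move=> Q QS Qflat Qphi t Qt; have [x xt] := p_surj t.
rewrite -xt; apply/pP; apply: (Pmax (Q \o p)) => [|v /pP pv|]; last by rewrite /= xt.
  split.
  - split; first by rewrite /= linear0; case: QS.
    by move=> r u v Qu Qv; rewrite /= linearP; apply: QS.2.
  - move=> n a u au; have [|m [B [y [Ba uy]]]] := Qflat n a (p \o u).
      move: au; rewrite /= linear_sum; congr Q; apply: eq_bigr => i _.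
      by rewrite linearZ.
    have [s sP] := choice p_surj; exists m, B, (s \o y); split=> // i.
    have psy : p (\sum_j (B j i : R) *: (s \o y) j) = \sum_j (B j i : R) *: y j.
      by rewrite linear_sum; apply: eq_bigr => j _; rewrite linearZ /= sP.
    by rewrite /= linearB psy; apply: uy.
  - by move=> v /Qphi; rewrite phi'P.
by rewrite /= pv; case: QS.
Qed.

End Reduction.

Section FlatPrecover.
Variables (R : pzRingType) (N : lmodType R).

Let W := skolem_term R N (pure_term R).
Let L : lmodType R := dsum (fun _ : W => R^o : lmodType R).

(** The index type of the precover: flat quotients of [L] equipped with a map to [N]. As [L] depends
    only on [R] and [N], the direct sum over all of them can be formed. *)
Record presentation := Presentation {
  pres_sub : L -> Prop;
  pres_map : {linear L -> N};
  pres_submodule : is_submodule pres_sub;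
  pres_flat : flat_modulo pres_sub;
  pres_map0 : forall x, pres_sub x -> pres_map x = 0 }.

Let fam (i : presentation) : lmodType R := quotient_module (pres_submodule i).

Let pres_proj i : {linear L -> fam i} := quotient_proj (pres_submodule i).

Let fam_mapP i := cid (surjective_factor (p := pres_proj i) (f := pres_map i)
  (@quotient_proj_surj _ _ _ (pres_submodule i))
  (fun v pv => pres_map0 ((quotient_proj_eq0 (pres_submodule i) v).1 pv))).

Let fam_map i : {linear fam i -> N} := sval (fam_mapP i).

Theorem flat_precover_exists :
  exists (F : lmodType R) (g : {linear F -> N}), flat_precover g.
Proof.
exists (dsum fam), (dsum_llift fam_map); split.
  apply: dsum_flat => i.
  apply/(surjective_flat (@quotient_proj_surj _ _ _ (pres_submodule i))
           (quotient_proj_eq0 (pres_submodule i))).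
  exact: pres_flat.
move=> F0 F0flat f0.
have [F [p [f [Fflat fred fp]]]] := flat_factors_reduced f0 F0flat.
have Fhull := reduced_skolem_hull Fflat fred.
have evL (w : W) : linear (fun r : R^o => (r : R) *: skolem_eval f w).
  by move=> r x y; rewrite scalerDl scalerA.
pose ev : {linear L -> F} := dsum_llift (fun w => linear_pack (@evL w)).
have ev_surj x : exists l, ev l = x.
  have [w <-] := Fhull x; exists (dsum_inj (fun _ : W => R^o : lmodType R) w 1).
  by rewrite dsum_llift_inj /= scale1r.
pose S l := ev l = 0.
have SS : is_submodule S.
  split; first exact: linear0.
  by move=> r x y; rewrite /S linearP => -> ->; rewrite scaler0 addr0.
have Sflat : flat_modulo S by apply/(surjective_flat ev_surj (P := S)).
have Sf x : S x -> (f \o ev) x = 0 by rewrite /S /= => ->; rewrite linear0.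
(* Evaluation of names is onto [F], so [F] is, up to isomorphism, the member of the family presented
   by the kernel of [ev]. *)
pose i := @Presentation S (f \o ev) SS Sflat Sf.
have [|h hP] := surjective_factor (p := ev) (f := pres_proj i) ev_surj.
  by move=> v ev0; apply/quotient_proj_eq0.
exists (dsum_inj fam i \o h \o p) => x.
rewrite -fp /=; have [l <-] := ev_surj (p x).
rewrite -[LHS]/(dsum_llift fam_map (dsum_inj fam i (h (ev l)))).
by rewrite dsum_llift_inj hP (svalP (fam_mapP i)).
Qed.

End FlatPrecover.

(** * Coherence and syzygies *)

Definition finite_syzygies (S : pzRingType) :=
  forall n (a : 'cV[S]_n), exists m (B : 'M[S]_(m, n)),
    B *m a = 0 /\ forall r : 'rV[S]_n, r *m a = 0 -> exists z, r = z *m B.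

Section Coherence.
Variable S : pzRingType.

Lemma linear_row_mx n (V : lmodType S) (f : {linear 'rV[S]_n -> V}) r :
  f r = \sum_i r 0 i *: f (delta_mx 0 i).
Proof.
by rewrite {1}[r]row_sum_delta linear_sum; apply: eq_bigr => i _; rewrite linearZ.
Qed.

Lemma mx11_eq0 (M : 'M[S]_1) : M 0 0 = 0 -> M = 0.
Proof. by move=> M0; apply/matrixP => i j; rewrite !ord1 M0 mxE. Qed.

(** A Schanuel-type comparison of the given generators, via [p], with a finite presentation [p'] of
    the same ideal: each map lifts through the other by matrices [C] and [D]. *)
Lemma coherent_finite_syzygies :
  (forall I : submodClosed S^o,
     finitely_generated (submod I) -> finitely_presented (submod I)) ->
  finite_syzygies S.
Proof.
move=> coh n a.
pose I0 : pred S^o := fun x => `[< exists r : 'rV[S]_n, x = (r *m a) 0 0 >].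
have I_closed : submod_closed I0.
  split=> [|c x y]; first by apply/asboolP; exists 0; rewrite mul0mx mxE.
  move=> /asboolP[r ->] /asboolP[s ->]; apply/asboolP; exists (c *: r + s).
  by rewrite mulmxDl -scalemxAl !mxE.
pose IC := GRing.isSubmodClosed.Build S S^o I0 (GRing.submod_closed_semi I_closed).
pose I : submodClosed S^o := HB.pack I0 IC.
have pI (r : 'rV[S]_n) : (r *m a) 0 0 \in I by apply/asboolP; exists r.
have pL : linear (fun r => Submod (pI r)).
  by move=> c r s; apply/val_inj; rewrite /= mulmxDl -scalemxAl !mxE.
pose p := linear_pack pL.
have p_eq0 r : p r = 0 <-> r *m a = 0.
  split=> [/(congr1 val)/= /mx11_eq0//|ra0].
  by apply/val_inj; rewrite /= ra0 mxE.
have p_surj w : exists r, p r = w.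
  case: w => x xI; have /asboolP[r xr] := xI; exists r.
  by apply/val_inj; rewrite /= -xr.
have [|m' [n' [q [p' [p'_surj p'_ker]]]]] := coh I; first by exists n, p.
have [c cP] := choice (fun i : 'I_n => p'_surj (p (delta_mx 0 i))).
have [d dP] := choice (fun l : 'I_n' => p_surj (p' (delta_mx 0 l))).
pose C := \matrix_i c i; pose D := \matrix_l d l.
have p'C r : p' (r *m C) = p r.
  rewrite mulmx_sum_row linear_sum linear_row_mx; apply: eq_bigr => i _.
  by rewrite linearZ rowK -cP.
have pD s : p (s *m D) = p' s.
  rewrite mulmx_sum_row linear_sum (linear_row_mx p'); apply: eq_bigr => i _.
  by rewrite linearZ rowK -dP.
pose Q := lin1_mx q.
(* If [p r = 0], then [r *m C = z *m Q] for some [z], whence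
   [r = r *m (1 - C *m D) + z *m Q *m D]. *)
exists (n + m')%N, (col_mx (1%:M - C *m D) (Q *m D)); split.
  rewrite mul_col_mx -[RHS]col_mx0; congr col_mx; apply/row_matrixP => i.
    rewrite row_mul linear0; apply/p_eq0.
    by rewrite rowE mulmxBr mulmx1 mulmxA linearB pD p'C subrr.
  rewrite row_mul linear0; apply/p_eq0; rewrite rowE mulmxA pD.
  by apply/p'_ker; exists (delta_mx 0 i); rewrite mul_rV_lin1.
move=> r /p_eq0 pr0; have [|z zr] := (p'_ker (r *m C)).1; first by rewrite p'C.
exists (row_mx r z); rewrite mul_row_col mulmxBr mulmx1 !mulmxA mul_rV_lin1 zr.
by rewrite subrK.
Qed.

Lemma finite_syzygies_coherent : finite_syzygies S ->
  forall I : submodClosed S^o,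
    finitely_generated (submod I) -> finitely_presented (submod I).
Proof.
move=> syz I [n [p p_surj]].
pose a : 'cV[S]_n := \col_i val (p (delta_mx 0 i)).
have pa r : val (p r) = (r *m a) 0 0.
  rewrite linear_row_mx linear_sum mxE; apply: eq_bigr => i _.
  by rewrite linearZ mxE.
have [m [B [Ba BP]]] := syz n a.
exists m, n, (mulmxr B), p; split=> // x; split=> [px0|[z <-]].
  have [|z ->] := BP x; last by exists z.
  by apply: mx11_eq0; rewrite -pa px0.
by apply/val_inj; rewrite pa /= -mulmxA Ba mulmx0 mxE.
Qed.

End Coherence.

Lemma right_coherentP (R : pzRingType) : right_coherent R <-> finite_syzygies R^c.
Proof.
split; first exact: coherent_finite_syzygies.
exact: finite_syzygies_coherent.
Qed.

(** * Coherence and flatness of the character modules of injective modules *)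

Section Single.
Variables (n : nat) (E : zmodType).

Fact ffun_single_additive i :
  zmod_morphism (fun e : E => [ffun k : 'I_n => if k == i then e else 0]).
Proof. by move=> x y; apply/ffunP => k; rewrite !ffunE; case: eqP; rewrite ?subr0. Qed.

Definition ffun_single i : {additive E -> {ffun 'I_n -> E}} :=
  additive_pack (@ffun_single_additive i).

Lemma ffun_sum_single (v : {ffun 'I_n -> E}) : v = \sum_i ffun_single i (v i).
Proof.
apply/ffunP => k; rewrite sum_ffunE (bigD1 k) //= big1 => [|i /negbTE ik].
  by rewrite ffunE eqxx addr0.
by rewrite ffunE eq_sym ik.
Qed.

End Single.

(** Let the rows of [B] generate the syzygies of [a]. By injectivity of [E], a tuple [e] killed by
    [B] is a multiple of [a], so [xi] kills it. Hence [xi] factors through [B] as a character [eta]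
    of E^m, whose components are the required [y_j]. *)
Lemma injective_char_flat_of_syzygies (R : pzRingType) (E : lmodType R^c) :
  finite_syzygies R^c -> injective_module E -> flat (rchar E).
Proof.
move=> syz Einj; apply/injective_char_flat/flat_modulo0_injective_char => n a xi axi.
have [m [B [Ba BP]]] := syz n a.
pose G (p : {ffun 'I_m -> E} * QmodZ) := exists e : 'I_n -> E,
  p = ([ffun j => \sum_i B j i *: e i], \sum_i (xi i : {additive E -> QmodZ}) (e i)).
have [||eta etaP] := @character_extend _ G.
- split.
    exists (fun=> 0); congr pair; last by rewrite big1 // => i _; rewrite raddf0.
    by apply/ffunP => j; rewrite !ffunE big1 // => i _; rewrite scaler0.
  move=> _ _ [e ->] [f ->]; exists (fun i => e i - f i); congr pair => /=.
    apply/ffunP => j; rewrite !ffunE -sumrB; apply: eq_bigr => i _.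
    by rewrite scalerBr.
  by rewrite -sumrB; apply: eq_bigr => i _; rewrite raddfB.
- move=> c [e [/esym/ffunP Be0 ->]].
  (* The map [r *m a |-> \sum_i r_i e_i] is well defined: a syzygy [r] is [z *m B], and [B] kills
     [e]. *)
  pose H (p : (R^c)^o * E) := exists r : 'rV[R^c]_n,
    p = ((r *m a) 0 0, \sum_i r 0 i *: e i).
  have HP : partial_linear H.
    split; first split.
    - exists 0; rewrite mul0mx mxE; congr pair.
      by rewrite big1 // => i _; rewrite mxE scale0r.
    - move=> s _ _ [r ->] [t ->]; exists (s *: r + t); congr pair => /=.
        by rewrite mulmxDl -scalemxAl !mxE.
      rewrite scaler_sumr -big_split; apply: eq_bigr => i _ /=.
      by rewrite !mxE scalerDl scalerA.
    - move=> f [r [/esym/mx11_eq0/BP[z ->] ->]].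
      under eq_bigr do rewrite mxE scaler_suml.
      rewrite exchange_big big1 // => j _ /=.
      have := Be0 j; rewrite !ffunE => Bj.
      transitivity (z 0 j *: \sum_i B j i *: e i); last by rewrite Bj scaler0.
      by rewrite scaler_sumr; apply: eq_bigr => i _; rewrite scalerA.
  have [g gP] := Einj _ H HP.
  have ge i : e i = (a i 0) *: g 1.
    rewrite -linearZ; apply/esym/gP; exists (delta_mx 0 i).
    congr pair; first by rewrite -rowE mxE [LHS]mulr1.
    rewrite (bigD1 i) //= big1 => [|k /negbTE ki]; rewrite mxE ?eqxx ?scale1r ?addr0 //.
    by rewrite ki andbF scale0r.
  under eq_bigr do rewrite ge.
  have /(congr1 (fun f : rchar E => (f : {additive E -> QmodZ}) (g 1))) := axi.
  by rewrite additive_sumE.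
pose h j : rchar E := eta \o @ffun_single m E j.
exists m, B, h; split=> // i; apply/eqP; rewrite subr_eq0; apply/eqP.
apply: additive_ext => e; rewrite additive_sumE.
transitivity (eta [ffun j => B j i *: e]).
  apply/esym/etaP; exists (fun k => if k == i then e else 0); congr pair.
    apply/ffunP => j; rewrite !ffunE (bigD1 i) //= eqxx big1 ?addr0 // => k /negbTE ->.
    by rewrite scaler0.
  by rewrite (bigD1 i) //= eqxx big1 ?addr0 // => k /negbTE ->; rewrite raddf0.
rewrite [X in eta X]ffun_sum_single raddf_sum; apply: eq_bigr => j _.
by rewrite ffunE.
Qed.

Lemma free_char_injective (R : pzRingType) (I : Type) :
  injective_module (lchar (dsum (fun _ : I => R^o : lmodType R))).
Proof. by apply/flat_injective_char/dsum_flat => i; apply: regular_flat. Qed.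

Section Syzygies.
Variables (R : pzRingType) (n : nat) (a : 'cV[R^c]_n).

Let J := {k : 'rV[R^c]_n | k *m a == 0}.
Let RR : lmodType R := R^o.
Let P : lmodType R := dsum (fun _ : J => RR).
Let inj (k : J) : {linear RR -> P} := dsum_inj (fun _ : J => RR) k.
Let cR := {additive RR -> QmodZ}.
Let cP := {additive P -> QmodZ}.

(** The element [e] in coordinate [k] of [lchar P], viewed as a product of copies of the character
    module of [R]. *)
Let delta (k : J) (e : cR) : cP :=
  dsum_lift (fun k' : J => if k' == k then e else \0 : cR).

Let deltaE k e k' r : delta k e (inj k' r) = if k' == k then e r else 0.
Proof. by rewrite /delta dsum_lift_inj; case: eqP. Qed.

Let pairing (t : J * ('I_n -> cR)) : QmodZ := \sum_i t.2 i (val t.1 0 i).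

(* The character of E^n, E = P^+, that pairs the summand R^+ at k with k itself
   and kills the multiples of a. *)
Lemma pairing_character : exists xi : {additive {ffun 'I_n -> lchar P} -> QmodZ},
  (forall e0 : lchar P, xi [ffun i => a i 0 *: e0] = 0) /\
  (forall k e, xi [ffun i => delta k (e i) : lchar P] = pairing (k, e)).
Proof.
pose G (p : {ffun 'I_n -> lchar P} * QmodZ) :=
  exists (e0 : lchar P) (l : seq (J * ('I_n -> cR))),
  p = ([ffun i => a i 0 *: e0 + \sum_(t <- l) (delta t.1 (t.2 i) : lchar P)],
       \sum_(t <- l) pairing t).
have [||xi xiP] := @character_extend _ G.
- split.
    exists 0, [::]; rewrite big_nil; congr pair; apply/ffunP => i.
    by rewrite !ffunE big_nil scaler0 addr0.
  move=> _ _ [e [l ->]] [f [l' ->]].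
  exists (e - f), (l ++ [seq (t.1, fun i => homN (t.2 i)) | t <- l']).
  have EN k (x : cR) : (delta k (homN x) : lchar P) = - (delta k x : lchar P).
    apply: additive_ext; apply: dsum_additive_ext => k' r.
    rewrite -[LHS]/(delta k (homN x) (inj k' r)) -[RHS]/(- (delta k x (inj k' r))).
    by rewrite !deltaE; case: eqP => //=; rewrite oppr0.
  congr pair => /=.
    apply/ffunP => i; rewrite !ffunE big_cat big_map /= scalerBr opprD addrACA.
    congr (_ + (_ + _)); rewrite -sumrN; apply: eq_bigr => t _.
    by rewrite EN.
  rewrite big_cat big_map /= -sumrN; congr (_ + _); apply: eq_bigr => t _.
  by rewrite /pairing -sumrN.
- move=> c [e0 [l [/esym/ffunP v0 ->]]].
  (* Evaluate component [i] of the vanishing tuple at [k_i] in summand [k] and add over [i]: the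
     multiple of [a] contributes nothing because [k] is a syzygy. *)
  have pk (k : J) : \sum_(t <- l | t.1 == k) pairing t = 0.
    have v0k i : (a i 0 *: e0 : cP) (inj k (val k 0 i)) +
        \sum_(t <- l) delta t.1 (t.2 i) (inj k (val k 0 i)) = 0.
      have := v0 i; rewrite !ffunE => /(congr1 (fun f : cP => f (inj k (val k 0 i)))).
      by rewrite -additive_sumE.
    have e0k : \sum_i (a i 0 *: e0 : cP) (inj k (val k 0 i)) = 0.
      transitivity ((e0 : cP) (inj k (\sum_i (a i 0 : R) *: (val k 0 i : RR)))).
        rewrite (linear_sum (inj k)) raddf_sum; apply: eq_bigr => i _.
        by rewrite (linearZ_LR (inj k)).
      have /eqP/matrixP/(_ 0 0) := valP k; rewrite !mxE => ka0.
      by rewrite [X in inj k X]ka0 !raddf0.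
    transitivity (\sum_i \sum_(t <- l) delta t.1 (t.2 i) (inj k (val k 0 i))).
      rewrite [RHS]exchange_big big_mkcond; apply: eq_bigr => t _.
      under [RHS]eq_bigr do rewrite deltaE eq_sym.
      by case: (eqVneq t.1 k) => [<-|_] //; rewrite big1.
    have : \sum_i ((a i 0 *: e0 : cP) (inj k (val k 0 i)) +
        \sum_(t <- l) delta t.1 (t.2 i) (inj k (val k 0 i))) = 0.
      by apply: big1 => i _; apply: v0k.
    by rewrite big_split /= e0k add0r.
  have -> : \sum_(t <- l) pairing t =
      \sum_(k <- undup [seq t.1 | t <- l]) \sum_(t <- l | t.1 == k) pairing t.
    under [RHS]eq_bigr do rewrite big_mkcond.
    rewrite [RHS]exchange_big /= big_seq [RHS]big_seq; apply: eq_bigr => t tl.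
    rewrite (bigD1_seq t.1) ?undup_uniq ?mem_undup ?map_f //= eqxx big1 ?addr0 //.
    by move=> k /negbTE; rewrite eq_sym => ->.
  by rewrite big1.
exists xi; split=> [e0|k e]; apply: xiP.
  exists e0, [::]; rewrite big_nil; congr pair; apply/ffunP => i.
  by rewrite !ffunE big_nil addr0.
exists 0, [:: (k, e)]; rewrite big_seq1; congr pair; apply/ffunP => i.
by rewrite !ffunE big_seq1 scaler0 add0r.
Qed.

(** The components of [xi] are annihilated by [a], so the criterion yields [B] and [y]. If a syzygy
    [r] were outside the row span of [B], a character [chi] with components [e] would kill the span
    but not [r]. Yet [chi r] is the value of [xi] at the tuple of the [delta k (e i)], where [k] is
    [r], and that value vanishes because [B] kills this tuple. *)
Lemma flat_char_syzygies : flat (rchar (lchar P)) ->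
  exists m (B : 'M[R^c]_(m, n)),
    B *m a = 0 /\ forall r : 'rV[R^c]_n, r *m a = 0 -> exists z, r = z *m B.
Proof.
move=> Eflat.
have {}Eflat := injective_char_flat_modulo0 (flat_injective_char Eflat).
have [xi [xia xid]] := pairing_character.
pose x i : rchar (lchar P) := xi \o @ffun_single n (lchar P) i.
have [|m [B [y [Ba xy]]]] := Eflat n a x.
  apply: additive_ext => e0; rewrite additive_sumE -[RHS](xia e0).
  rewrite [X in _ = xi X]ffun_sum_single raddf_sum; apply: eq_bigr => i _.
  by rewrite ffunE.
exists m, B; split=> // r ra0; apply: contrapT => nr.
have [||chi chir chiB] := @character_separates 'rV[R^c]_n
  (fun r => exists z, r = z *m B) r => //.
  split; first by exists 0; rewrite mul0mx.
  by move=> _ _ [z ->] [z' ->]; exists (z - z'); rewrite mulmxBl.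
have eA i : zmod_morphism (fun s : RR => chi ((s : R^c) *: delta_mx 0 i)).
  by move=> s t; rewrite scalerBl raddfB.
pose e i : cR := additive_pack (@eA i).
have ra0' : r *m a == 0 by apply/eqP.
pose k : J := exist _ r ra0'.
case: chir; transitivity (pairing (k, e)).
  by rewrite {1}[r]row_sum_delta raddf_sum.
rewrite -xid [X in xi X]ffun_sum_single raddf_sum.
have xE i : xi (@ffun_single n (lchar P) i (delta k (e i) : lchar P)) =
    \sum_j (y j : {additive lchar P -> QmodZ}) (B j i *: (delta k (e i) : lchar P)).
  have /eqP := xy i; rewrite subr_eq0 => /eqP.
  move=> /(congr1 (fun f : {additive lchar P -> QmodZ} => f (delta k (e i) : lchar P))).
  by rewrite additive_sumE.
under eq_bigr do rewrite ffunE xE.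
rewrite exchange_big big1 // => j _ /=.
rewrite -raddf_sum; suff -> : \sum_i B j i *: (delta k (e i) : lchar P) = 0.
  by rewrite raddf0.
apply: additive_ext; apply: dsum_additive_ext => k' s.
rewrite additive_sumE.
transitivity (\sum_i delta k (e i) (inj k' ((B j i : R) *: s))).
  by apply: eq_bigr => i _; rewrite linearZ_LR.
under eq_bigr do rewrite deltaE.
case: eqP => _; last by rewrite big1.
(* In coordinate [k] the combination is [chi] at a multiple of row [j] of [B]. *)
rewrite /= -raddf_sum chiB //; exists ((s : R^c) *: delta_mx 0 j).
rewrite -scalemxAl -rowE; apply/rowP => i.
rewrite mxE summxE (bigD1 i) //= big1 => [|l /negbTE li].
  by rewrite !mxE !eqxx addr0 [LHS]mulr1.
by rewrite !mxE eq_sym li andbF mulr0.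
Qed.

End Syzygies.

(** * The adjunction between the two character modules *)

Section Adjunction.
Variables (R : pzRingType) (M : lmodType R) (N : lmodType R^c).

Let ev (V : zmodType) (f : {additive V -> QmodZ}) x := f x.

Section Flip.
Variable f : {linear N -> lchar M}.

Fact char_flip_additive m : zmod_morphism (fun n => ev (f n) m).
Proof. by move=> x y; rewrite linearB. Qed.

Fact char_flip_linear :
  linear (fun m => additive_pack (char_flip_additive m) : rchar N).
Proof.
move=> r x y; apply: additive_ext => n /=.
by rewrite /ev linearZ_LR raddfD.
Qed.

Definition char_flip : {linear M -> rchar N} := linear_pack char_flip_linear.

End Flip.

Section Unflip.
Variable f : {linear M -> rchar N}.

Fact char_unflip_additive n : zmod_morphism (fun m => ev (f m) n).
Proof. by move=> x y; rewrite linearB. Qed.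

Fact char_unflip_linear :
  linear (fun n => additive_pack (char_unflip_additive n) : lchar M).
Proof.
move=> r x y; apply: additive_ext => m /=.
by rewrite /ev linearZ_LR raddfD.
Qed.

Definition char_unflip : {linear N -> lchar M} := linear_pack char_unflip_linear.

End Unflip.

End Adjunction.

(** * Embedding a module into an injective one *)

Section CharacterEmbedding.
Variables (R : pzRingType) (N : lmodType R^c).

Let RR : lmodType R := R^o.
Let P : lmodType R := dsum (fun _ : rchar N => RR).

Fact orbit_char_additive (n : N) (chi : {additive N -> QmodZ}) :
  zmod_morphism (fun r : RR => chi ((r : R^c) *: n)).
Proof. by move=> r s; rewrite scalerBl raddfB. Qed.

(** The canonical map from [N] to its double character module, followed by the dual of the free
    cover of [rchar N] by [P]. *)
Definition char_embed_fun (n : N) : {additive P -> QmodZ} :=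
  dsum_lift (fun chi : rchar N => additive_pack (orbit_char_additive n chi)).

Lemma char_embed_funE n (chi : rchar N) (r : R) :
  char_embed_fun n (dsum_inj (fun _ : rchar N => RR) chi r) =
  (chi : {additive N -> QmodZ}) ((r : R^c) *: n).
Proof. exact: dsum_lift_inj. Qed.

Fact char_embed_linear : linear (char_embed_fun : N -> lchar P).
Proof.
move=> r x y; apply: additive_ext; apply: dsum_additive_ext => chi s.
rewrite -[LHS]/(char_embed_fun (r *: x + y) (dsum_inj (fun _ : rchar N => RR) chi s)).
rewrite -[RHS]/(char_embed_fun x ((r : R) *: (dsum_inj (fun _ : rchar N => RR) chi s : P))
  + char_embed_fun y (dsum_inj (fun _ : rchar N => RR) chi s)).
rewrite -linearZ_LR !char_embed_funE -raddfD; congr (_ _).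
by rewrite scalerDr scalerA.
Qed.

Definition char_embed : {linear N -> lchar P} := linear_pack char_embed_linear.

Lemma char_embed_inj : injective char_embed.
Proof.
apply: raddf_inj => n n0; apply: contrapT => nn0.
have [||chi chin _] := @character_separates N (fun x => x = 0) n => //.
  by split=> // x y -> ->; rewrite subr0.
case: chin; rewrite -[n]scale1r -[LHS](char_embed_funE n chi 1).
have /(congr1 (fun f : {additive P -> QmodZ} =>
  f (dsum_inj (fun _ : rchar N => RR) chi 1))) := n0.
by [].
Qed.

Lemma enough_injectives : exists (E : lmodType R^c) (i : {linear N -> E}),
  injective_module E /\ injective i.
Proof.
by exists (lchar P), char_embed; split; [apply: free_char_injective|apply: char_embed_inj].
Qed.

End CharacterEmbedding.

(** * Flat precover completing domains and subinjectivity domains *)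

Lemma flat_retract (R : pzRingType) (F V : lmodType R) (g : {linear F -> V})
    (h : {linear V -> F}) : g \o h =1 id -> flat F -> flat V.
Proof.
move=> gh /flat_injective_char/injective_char_flat_modulo0 Fflat.
apply/injective_char_flat/flat_modulo0_injective_char => n a x ax0.
have [|m [B [y [Ba xy]]]] := Fflat n a (h \o x).
  rewrite -[RHS](linear0 h) -ax0 linear_sum; apply: eq_bigr => i _.
  by rewrite linearZ.
exists m, B, (g \o y); split=> // i; apply/eqP; rewrite subr_eq0; apply/eqP.
have /eqP := xy i; rewrite subr_eq0 => /eqP /(congr1 g) ghx.
rewrite -[x i]gh [LHS]ghx linear_sum; apply: eq_bigr => j _.
by rewrite linearZ.
Qed.

Lemma completing_subinjectivity (R : pzRingType) (M : lmodType R) (N : lmodType R^c) :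
  flat_precover_completing_domain M (rchar N) -> subinjectivity_domain (lchar M) N.
Proof.
move=> comp K i i_inj f.
have [F [g gcov]] := flat_precover_exists (rchar N).
have [h hP] := comp (char_flip f) F g gcov.
have [k kP] := injective_module_extend (char_unflip g)
  (flat_injective_char gcov.1) i_inj.
(* This is [k] followed by the dual of [h], written through the adjunction. *)
exists (char_unflip (char_flip k \o h)) => n; apply: additive_ext => m.
have /(congr1 (fun c : {additive F -> QmodZ} => c (h m))) := kP n.
have /(congr1 (fun c : {additive N -> QmodZ} => c n)) := hP m.
by move=> /= hm kn; rewrite /= kn hm.
Qed.

Lemma coherent_completing (R : pzRingType) (M : lmodType R) (N : lmodType R^c) :
  right_coherent R -> subinjectivity_domain (lchar M) N ->
  flat_precover_completing_domain M (rchar N).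
Proof.
move=> /right_coherentP syz Nsub f F g [Fflat gP].
have [E [i [Einj i_inj]]] := enough_injectives N.
have [e eP] := Nsub E i i_inj (char_unflip f).
(* Restriction of characters along [i]; its source is flat by coherence, so it lifts along [g]. *)
have rL : linear (fun c : rchar E => (c : {additive E -> QmodZ}) \o i : rchar N).
  by move=> r c d; apply: additive_ext => n /=; rewrite linearZ_LR.
have [l lP] := gP _ (injective_char_flat_of_syzygies syz Einj) (linear_pack rL).
exists (l \o char_flip e) => m; rewrite [LHS]lP; apply: additive_ext => n /=.
by have /(congr1 (fun c : {additive M -> QmodZ} => c m)) := eP n.
Qed.

Lemma completing_coherent (R : pzRingType) :
  (forall (M : lmodType R) (N : lmodType R^c),
     subinjectivity_domain (lchar M) N ->
     flat_precover_completing_domain M (rchar N)) ->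
  right_coherent R.
Proof.
move=> comp; apply/right_coherentP => n a; apply: flat_char_syzygies.
set E := lchar _.
have Einj : injective_module E by apply: free_char_injective.
have [F [g gcov]] := flat_precover_exists (rchar E).
have [|h hP] := comp (rchar E) E _ idfun F g gcov.
  (* An injective [E] is a retract of every overmodule, so every map out of [E] extends. *)
  move=> K i i_inj f; have [k kP] := injective_module_extend idfun Einj i_inj.
  by exists (f \o k) => x; rewrite /= [k _]kP.
exact: flat_retract hP gcov.1.
Qed.

Theorem proposition4p1 (R : pzRingType) :
  (forall (M : lmodType R) (N : lmodType R^c),
     flat_precover_completing_domain M (rchar N) ->
     subinjectivity_domain (lchar M) N) /\
  (right_coherent R <->
   forall (M : lmodType R) (N : lmodType R^c),
     subinjectivity_domain (lchar M) N ->
     flat_precover_completing_domain M (rchar N)).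
Proof.
split; first exact: completing_subinjectivity.
split=> [coh M N|]; first exact: coherent_completing.
exact: completing_coherent.
Qed.
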